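(* There are universal constants $c,C,C_1,C_2>0$ such that the following holds. Let $X,W\in\mathbb{R}^{n\times k}$ and $\mathbf{e}\in\mathbb{R}^n$ be random, following the sub-Gaussian design model with parameters $(\frac1n\Sigma_x,\frac1n)$, $(\frac1n\Sigma_w,\frac1n\sigma_w^2)$ and $(\frac1n\sigma^2,\frac1n\sigma_e^2)$ respectively, with $\lambda_{\min}(\Sigma_x)>0$. Let $\beta^*\in\mathbb{R}^k$, $\mathbf{y}=X\beta^*+\mathbf{e}$ and $Z=X+W$. Let $p\ge k$ and suppose $$n\ge c\,\frac{(1+\sigma_w^2)^2}{\lambda_{\min}^2(\Sigma_x)}\,k\log p .$$ Then, with probability at least $1-C_1p^{-C_2}$, the matrix $\hat\Sigma=Z^\top Z-\Sigma_w$ is positive definite and the estimator $\hat\beta=\hat\Sigma^{-1}\hat\gamma$ with $\hat\gamma=Z^\top\mathbf{y}$ satisfies $$\|\hat\beta-\beta^*\|_2\le C\,\frac{(\sigma_w+\sigma_w^2)\|\beta^*\|_2+\sigma_e\sqrt{1+\sigma_w^2}}{\lambda_{\min}(\Sigma_x)}\sqrt{\frac{k\log p}{n}} .$$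
   Context: Definitions. A zero-mean real random variable $v$ is sub-Gaussian with parameter $\sigma_v$ if $\mathbb{E}[\exp(\lambda v)]\le\exp(\sigma_v^2\lambda^2/2)$ for all $\lambda\in\mathbb{R}$. A zero-mean random matrix $V$ with $n$ rows and $q$ columns is sub-Gaussian with parameter $(\frac1n\Sigma,\frac1n\sigma^2)$ if (1) its rows $\mathbf{v}_1^\top,\dots,\mathbf{v}_n^\top$ are independent with $\mathbb{E}[\mathbf{v}_i\mathbf{v}_i^\top]=\frac1n\Sigma$ for every $i$, and (2) for every unit vector $\mathbf{u}\in\mathbb{R}^q$, $\mathbf{u}^\top\mathbf{v}_i$ is sub-Gaussian with parameter at most $\frac{1}{\sqrt n}\sigma$. Sub-Gaussian design model: $X$, $W$, $\mathbf{e}$ (the last viewed as an $n\times1$ matrix) are sub-Gaussian with parameters $(\frac1n\Sigma_x,\frac1n)$, $(\frac1n\Sigma_w,\frac1n\sigma_w^2)$, $(\frac1n\sigma^2,\frac1n\sigma_e^2)$ respectively, and are independent of each other. No independence between columns is assumed. Thus $\Sigma_w=\mathbb{E}[W^\top W]$, $\Sigma_x=\mathbb{E}[X^\top X]$. Universal constants do not depend on $n,p,k$ or any of the variance parameters. $p$ is only a parameter indexing the guarantee. *)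

(* Defs.v *)
From HB Require Import structures.
From mathcomp Require Import all_boot all_order all_algebra.
From mathcomp Require Import all_classical all_reals all_analysis.

Set Implicit Arguments.
Unset Strict Implicit.
Unset Printing Implicit Defensive.

Import Order.TTheory GRing.Theory Num.Theory.
Import numFieldNormedType.Exports.

Local Open Scope classical_set_scope.
Local Open Scope ring_scope.

(* The norm [`|v|] that MathComp-Analysis puts on matrices is the sup norm. *)
Definition l2norm (R : realType) (q : nat) (v : 'cV[R]_q) : R :=
  Num.sqrt (\sum_i v i 0 ^+ 2).

(* Only used for symmetric matrices of positive size, whose set of real
   eigenvalues is finite and nonempty, so that [inf] is a minimum. *)
Definition lambda_min (R : realType) (q : nat) (A : 'M[R]_q) : R :=
  inf [set a : R | eigenvalue A a].

Definition posdef (R : realType) (q : nat) (A : 'M[R]_q) : Prop :=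
  A^T = A /\ forall v : 'cV[R]_q, v != 0 -> 0 < (v^T *m A *m v) 0 0.

Section probability_notions.
Context (d : measure_display) (T : measurableType d) (R : realType).
Variable P : probability T R.

Definition borel_mx (m q : nat) : set (set 'M[R]_(m, q)) :=
  <<s [set A : set 'M[R]_(m, q) | open A] >>.

Definition random_mx (m q : nat) (V : T -> 'M[R]_(m, q)) : Prop :=
  forall B, borel_mx B -> measurable (V @^-1` B).

Definition sigma_of (m q : nat) (V : T -> 'M[R]_(m, q)) : set (set T) :=
  [set V @^-1` B | B in @borel_mx m q].

(* Mutual independence of the sigma-algebras F i. *)
Definition mutually_independent (I : finType) (F : I -> set (set T)) : Prop :=
  forall (J : {set I}) (E : I -> set T),
    (forall i, i \in J -> F i (E i)) ->
    P (\bigcap_(i in [set` J]) E i) = (\prod_(i in J) P (E i))%E.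

(* ['E_P[v] = 0] includes integrability: for measurable v, a positive or
   negative part with infinite integral would make ['E_P[v]] infinite. *)
Definition sub_gaussian (v : T -> R) (s : R) : Prop :=
  [/\ measurable_fun setT v,
      ('E_P[v] = 0)%E &
      forall l : R, ('M_P v l <= (expR (s ^+ 2 * l ^+ 2 / 2))%R%:E)%E].

(* Sub-Gaussian with parameter (n^-1 Sigma, n^-1 sigma^2): the factor n^-1 is
   supplied here and is not part of the arguments Sigma and sigma. *)
Definition sub_gaussian_mx (n q : nat) (V : T -> 'M[R]_(n, q))
    (Sigma : 'M[R]_q) (sigma : R) : Prop :=
  [/\ random_mx V,
      forall i j, ('E_P[fun t => V t i j] = 0)%E,
      mutually_independent (fun i : 'I_n => sigma_of (fun t => row i (V t))),
      forall (i : 'I_n) (j l : 'I_q),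
        ('E_P[fun t => (V t i j * V t i l)%R] = (n%:R^-1 * Sigma j l)%R%:E)%E &
      forall (i : 'I_n) (u : 'cV[R]_q), l2norm u = 1 ->
        exists s : R, [/\ 0 <= s, s <= (Num.sqrt n%:R)^-1 * sigma &
          sub_gaussian (fun t => (row i (V t) *m u) 0 0) s]].

Definition sub_gaussian_design (n k : nat)
    (X W : T -> 'M[R]_(n, k)) (e : T -> 'cV[R]_n)
    (Sigma_x Sigma_w : 'M[R]_k) (sigma_w sigma sigma_e : R) : Prop :=
  [/\ sub_gaussian_mx X Sigma_x 1,
      sub_gaussian_mx W Sigma_w sigma_w,
      sub_gaussian_mx e (sigma ^+ 2)%:M sigma_e &
      mutually_independent
        (tnth [tuple sigma_of X; sigma_of W; sigma_of e])].

(* The event E contains a measurable event of probability at least r; this is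
   [r%:E <= P E] when E is measurable, and avoids the unspecified value of P on
   sets not known to be measurable. *)
Definition with_prob_at_least (r : R) (E : set T) : Prop :=
  exists A : set T, [/\ measurable A, A `<=` E & (r%:E <= P A)%E].

End probability_notions.

(* Main.v *)
Require Import Defs.
From HB Require Import structures.
From mathcomp Require Import all_boot all_order all_algebra.
From mathcomp Require Import all_classical all_reals all_analysis.
From mathcomp Require Import measurable_realfun ring lra.

Set Implicit Arguments.
Unset Strict Implicit.
Unset Printing Implicit Defensive.

Import Order.TTheory GRing.Theory Num.Theory.
Import numFieldNormedType.Exports HBNNSimple.

Local Open Scope classical_set_scope.
Local Open Scope ring_scope.

(** The plan is to show that, on one event of high probability, the
    estimating equation is a small perturbation of an invertible system.

    Write Z = X + W and let the residual be Z^T y minus Sigma_hat times beta.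
    Then Sigma_hat applied to the error beta_hat - beta is the residual
      X^T e + W^T e - X^T W beta - (W^T W - Sigma_w) beta,
    and Sigma_hat differs from Sigma_x by
      (X^T X - Sigma_x) + (W^T W - Sigma_w) + X^T W + W^T X.
    So it is enough to bound the terms of the residual in Euclidean norm, and
    those of the difference in operator norm, by multiples of tau, a constant
    times sqrt (k log p / n). The lower bound on n makes the difference at
    most lambda_min / 2, which gives positive definiteness
    ([Sigma_hat_coercive]), and then the error is at most 2 / lambda_min times
    the norm of the residual ([estimator_error]).

    Each deviation is controlled through finitely many scalars. A grid of at
    most 64^k points is a 1/4-net of the unit sphere ([net_covers],
    [card_net]), and passing from the sphere to the net costs a factor 2, for
    quadratic forms ([bil_le_net]) as well as for vectors ([l2norm_le_net]).
    For a fixed grid point every scalar is a sum over the n rows, either of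
    centred squares of sub-Gaussian variables ([bernstein_quadratic]) or of
    products of two independent ones ([bernstein_cross]), and satisfies a
    Bernstein bound on its moment generating function. The Chernoff bound
    gives a tail exp (- 16 k log p) = p^(-16 k), which beats the at most
    p^(6 k) points of the net ([net_failure_le]).

    The moment generating function of a centred square comes from
    E exp (v^2 / (4 s^2)) <= 8 for v sub-Gaussian with parameter s
    ([integral_expR_sqr_le8]), proved by dominating the left side by a
    discrete mixture of exponentials exp (j v / s), and from a second-order
    expansion ([mgf_centered_sqr]). For products, one freezes one factor: the
    sum is then sub-Gaussian in the other one, with a variance proxy that is
    a sum of squares. The two consequences of independence that this uses are
    the product formula for expectations ([integral_prod_independent]) and
    the replacement of two independent copies of the sample point by one
    ([integral_decouple_le]). *)

(** * Elementary inequalities for the exponential *)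

Section real_inequalities.
Variable R : realType.
Implicit Types x y z : R.

Lemma expR_half_le2 : expR (2^-1) <= 2 :> R.
Proof.
rewrite -[leLHS]invrK -expRN invf_ple ?posrE ?expR_gt0//.
by apply: le_trans (expR_ge1Dx _); lra.
Qed.

Lemma expR_quarter_le : expR (4^-1) <= 4 / 3 :> R.
Proof.
rewrite -[leLHS]invrK -expRN invf_ple ?posrE ?expR_gt0//.
by rewrite invf_div; apply: le_trans (expR_ge1Dx _); lra.
Qed.

Lemma expRN_half_le : expR (- 2^-1) <= 2 / 3 :> R.
Proof.
rewrite expRN invf_ple ?posrE ?expR_gt0//.
by rewrite invf_div; apply: le_trans (expR_ge1Dx _); lra.
Qed.

Lemma sqr_le_expR x : 0 <= x -> x ^+ 2 / 2 <= expR x.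
Proof.
move=> x0; apply: le_trans (expR_ge1Dxn 1 x0).
by rewrite (_ : 2`! = 2%N)// lerDr.
Qed.

Lemma sqr_le_cosh x : x ^+ 2 <= 2 * (expR x + expR (- x)).
Proof.
have [x0|x0] := leP 0 x.
  have := sqr_le_expR x0; have := expR_ge0 (- x).
  by move: (expR x) (expR (- x)) => a b; nra.
have /sqr_le_expR : 0 <= - x by lra.
rewrite sqrrN; have := expR_ge0 x.
by move: (expR x) (expR (- x)) => a b; nra.
Qed.

(** For either sign of z this follows from the tangent bound
    1 - z <= exp (- z), multiplied by exp z. *)
Lemma expR_le_quadratic z : expR z <= 1 + z + z ^+ 2 * expR `|z|.
Proof.
have [z0|z0] := leP 0 z.
  rewrite ger0_norm//; have [z1|z1] := leP 1 z.
    have : expR z <= z ^+ 2 * expR z by rewrite ler_peMl ?expR_ge0// exprn_ege1.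
    by move: (expR z) (z ^+ 2 * _) => a b; lra.
  have := expR_ge1Dx (- z); rewrite expRN.
  have := expR_gt0 z; move: (expR z) => a a0 h.
  have {}h : a * (1 - z) <= 1.
    by rewrite mulrC -ler_pdivlMr// div1r.
  have : a * (1 - z) * (1 + z) <= 1 + z by rewrite ler_piMl//; lra.
  by rewrite (_ : a * _ * _ = a - z ^+ 2 * a); [lra|ring].
rewrite ltr0_norm//.
have := expR_ge1Dx (- z); rewrite expRN.
have := expR_gt0 z; move: (expR z) => a a0 h.
have a1 : a * (1 - z) <= 1.
  by rewrite mulrC -ler_pdivlMr// div1r.
suff : a <= 1 + z + z ^+ 2.
  move/le_trans; apply; rewrite lerD2l; rewrite ler_peMr ?sqr_ge0//.
  by apply: le_trans h; lra.
have a2 : a <= (1 - z)^-1.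
  by rewrite -[leRHS]div1r ler_pdivlMr//; lra.
apply: le_trans a2 _; rewrite -[leLHS]div1r ler_pdivrMr; last lra.
have : 0 <= (- z) ^+ 3 by rewrite exprn_ge0//; lra.
by rewrite (_ : _ * (1 - z) = 1 + (- z) ^+ 3); [lra|ring].
Qed.

(** Completing the square: j is the integer nearest to |x|/2, so the
    exponent falls short of x^2/4 by at most 1/4. *)
Lemma expR_sqr_le_discrete x : exists j : nat,
  expR (x ^+ 2 / 4) <=
    4 / 3 * (expR (j%:R * x - j%:R ^+ 2) + expR (- j%:R * x - j%:R ^+ 2)).
Proof.
pose j := Num.truncn (`|x| / 2 + 2^-1).
have jb : `| `|x| / 2 - j%:R| <= 2^-1.
  have /truncn_itv : 0 <= `|x| / 2 + 2^-1 :> R by have := normr_ge0 x; lra.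
  rewrite -/j -[j.+1%:R]natr1 => /andP[h1 h2].
  by rewrite ler_norml; apply/andP; split; lra.
exists j.
have key : expR (x ^+ 2 / 4) <= 4 / 3 * expR (j%:R * `|x| - j%:R ^+ 2).
  rewrite -ler_pdivrMr ?expR_gt0// -expRN -expRD.
  apply: le_trans expR_quarter_le; rewrite ler_expR.
  have : (`|x| / 2 - j%:R) ^+ 2 <= 4^-1.
    rewrite -real_normK ?num_real//.
    have := normr_ge0 (`|x| / 2 - j%:R); move: jb.
    by set b := `|_ - _|; nra.
  rewrite -[in x ^+ 2](real_normK (num_real x)); move: (`|x|) => b; lra.
apply: le_trans key _; rewrite ler_pM2l; last lra.
have [x0|x0] := leP 0 x; first by rewrite ger0_norm// lerDl expR_ge0.
by rewrite ltr0_norm// mulrN mulNr lerDr expR_ge0.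
Qed.

Lemma sum_geometric_le (q : R) (n : nat) : 0 <= q < 1 ->
  \sum_(j < n) q ^+ j <= (1 - q)^-1.
Proof.
move=> /andP[q0 q1].
rewrite -[leRHS]div1r ler_pdivlMr ?subr_gt0// mulrC -opprB mulNr -subrX1 opprB.
by rewrite gerBl exprn_ge0.
Qed.

End real_inequalities.

(** * Quadratic forms and the smallest eigenvalue *)

Section bilinear.
Context (R : realType) (k : nat).
Implicit Types (A B : 'M[R]_k) (x y z : 'cV[R]_k).

Definition bil A x y : R := (x^T *m A *m y) 0 0.

Lemma bilE A x y : bil A x y = \sum_i \sum_j A i j * (x i 0 * y j 0).
Proof.
rewrite /bil mxE exchange_big/=; apply: eq_bigr => j _.
rewrite mxE mulr_suml; apply: eq_bigr => i _.
by rewrite mxE; ring.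
Qed.

Lemma bilDl A x y z : bil A (x + y) z = bil A x z + bil A y z.
Proof. by rewrite /bil linearD/= !mulmxDl mxE. Qed.

Lemma bilDr A x y z : bil A z (x + y) = bil A z x + bil A z y.
Proof. by rewrite /bil mulmxDr mxE. Qed.

Lemma bilZl A c x y : bil A (c *: x) y = c * bil A x y.
Proof. by rewrite /bil linearZ/= -!scalemxAl mxE. Qed.

Lemma bilZr A c x y : bil A x (c *: y) = c * bil A x y.
Proof. by rewrite /bil -scalemxAr mxE. Qed.

Lemma bilC A x y : A^T = A -> bil A x y = bil A y x.
Proof.
move=> sA; rewrite !bilE exchange_big/=.
apply: eq_bigr => i _; apply: eq_bigr => j _.
by rewrite -[in A j i]sA mxE; ring.
Qed.

Lemma bil_addmx A B x y : bil (A + B) x y = bil A x y + bil B x y.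
Proof. by rewrite /bil mulmxDr mulmxDl mxE. Qed.

Lemma bil_oppmx A x y : bil (- A) x y = - bil A x y.
Proof. by rewrite /bil mulmxN mulNmx mxE. Qed.

Lemma bil_scalar_mx c x y : bil c%:M x y = c * bil 1%:M x y.
Proof. by rewrite /bil mul_mx_scalar mulmx1 -scalemxAl mxE. Qed.

Lemma l2norm_ge0 x : 0 <= l2norm x.
Proof. exact: sqrtr_ge0. Qed.

Lemma l2norm_sqr x : l2norm x ^+ 2 = bil 1%:M x x.
Proof.
rewrite sqr_sqrtr; last by apply: sumr_ge0 => i _; exact: sqr_ge0.
by rewrite /bil mulmx1 mxE; apply: eq_bigr => i _; rewrite mxE expr2.
Qed.

Lemma l2normZ c x : l2norm (c *: x) = `|c| * l2norm x.
Proof.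
rewrite /l2norm; under eq_bigr do rewrite mxE exprMn.
by rewrite -mulr_sumr sqrtrM ?sqr_ge0// sqrtr_sqr.
Qed.

Lemma l2norm_eq0 x : (l2norm x == 0) = (x == 0).
Proof.
apply/idP/eqP => [|->]; last first.
  by rewrite /l2norm big1 ?sqrtr0// => i _; rewrite mxE expr0n.
rewrite sqrtr_eq0 => h; apply/matrixP => i j; rewrite ord1 mxE.
have : \sum_i x i 0 ^+ 2 == 0.
  by rewrite eq_le h sumr_ge0// => a _; exact: sqr_ge0.
rewrite psumr_eq0; last by move=> a _; exact: sqr_ge0.
by move=> /allP/(_ i (mem_index_enum _)); rewrite sqrf_eq0 => /eqP.
Qed.

Lemma l2norm0 : l2norm (0 : 'cV[R]_k) = 0.
Proof. by apply/eqP; rewrite l2norm_eq0. Qed.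

Lemma l2norm_gt0 x : (0 < l2norm x) = (x != 0).
Proof. by rewrite lt_neqAle l2norm_ge0 andbT eq_sym l2norm_eq0. Qed.

Lemma l2norm_normalize x : x != 0 -> l2norm ((l2norm x)^-1 *: x) = 1.
Proof.
rewrite -l2norm_gt0 => x0.
by rewrite l2normZ gtr0_norm ?invr_gt0// mulVf ?gt_eqF.
Qed.

(** Nonnegativity of the quadratic form on the line x + t y bounds its
    discriminant. *)
Lemma psd_Cauchy_Schwarz A x y : A^T = A -> (forall z, 0 <= bil A z z) ->
  bil A x y ^+ 2 <= bil A x x * bil A y y.
Proof.
move=> sA A0; have line t : 0 <= bil A x x + 2 * t * bil A x y + t ^+ 2 * bil A y y.
  rewrite (_ : _ + _ = bil A (x + t *: y) (x + t *: y)) ?A0//.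
  by rewrite bilDl !bilDr !(bilZl, bilZr) (bilC y x sA); ring.
move: (A0 x) (A0 y) line; set a := bil A x x; set b := bil A x y; set c := bil A y y.
move=> a0 c0 line.
have [ceq0|c_neq0] := eqVneq c 0.
  rewrite ceq0 mulr0; have [->|b0] := eqVneq b 0; first by rewrite expr0n.
  have := line (- (a + 1) / (2 * b)).
  rewrite ceq0 mulr0 addr0 (_ : 2 * _ * b = - (a + 1)); last by field.
  by lra.
have cgt0 : 0 < c by rewrite lt_neqAle eq_sym c_neq0.
have := line (- b / c).
rewrite (_ : _ + _ = a - b ^+ 2 / c); last by field.
by rewrite subr_ge0 ler_pdivrMr.
Qed.

Lemma Cauchy_Schwarz x y : `|bil 1%:M x y| <= l2norm x * l2norm y.
Proof.
rewrite -ler_sqr ?nnegrE ?mulr_ge0 ?l2norm_ge0// real_normK ?num_real//.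
rewrite exprMn !l2norm_sqr; apply: psd_Cauchy_Schwarz.
  by rewrite trmx1.
by move=> z; rewrite -l2norm_sqr sqr_ge0.
Qed.

Lemma l2normD x y : l2norm (x + y) <= l2norm x + l2norm y.
Proof.
rewrite -ler_sqr ?nnegrE ?addr_ge0 ?l2norm_ge0// l2norm_sqr bilDl !bilDr -!l2norm_sqr sqrrD.
rewrite (bilC y x) ?trmx1//.
have := le_trans (ler_norm _) (Cauchy_Schwarz x y).
by rewrite mulr2n; set a := bil _ _ _; lra.
Qed.

Lemma l2normN x : l2norm (- x) = l2norm x.
Proof. by rewrite -scaleN1r l2normZ normrN1 mul1r. Qed.

Lemma normr_entry_le x i : `|x i 0| <= l2norm x.
Proof.
rewrite -sqrtr_sqr ler_wsqrtr// (bigD1 i)//= lerDl.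
by apply: sumr_ge0 => j _; exact: sqr_ge0.
Qed.

Lemma bil_le_entries A x y :
  `|bil A x y| <= (\sum_i \sum_j `|A i j|) * (l2norm x * l2norm y).
Proof.
rewrite bilE mulr_suml; apply: le_trans (ler_norm_sum _ _ _) _.
apply: ler_sum => i _; rewrite mulr_suml; apply: le_trans (ler_norm_sum _ _ _) _.
apply: ler_sum => j _; rewrite !normrM ler_wpM2l//.
by apply: ler_pM => //; exact: normr_entry_le.
Qed.

Lemma bil_mulmx A x y : bil 1%:M x (A *m y) = bil A x y.
Proof. by rewrite /bil mulmx1 mulmxA. Qed.

Lemma mulmx_norm_le A x :
  l2norm (A *m x) <= (\sum_i \sum_j `|A i j|) * l2norm x.
Proof.
have [->|Ax0] := eqVneq (A *m x) 0.
  by rewrite l2norm0 mulr_ge0 ?l2norm_ge0// sumr_ge0// => i _; rewrite sumr_ge0.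
rewrite -(@ler_pM2l _ (l2norm (A *m x))) ?l2norm_gt0// -expr2 l2norm_sqr.
rewrite bil_mulmx mulrCA; apply: le_trans (bil_le_entries _ _ _).
exact: ler_norm.
Qed.

End bilinear.

Section smallest_eigenvalue.
Context (R : realType) (k : nat).
Implicit Types (A B : 'M[R]_k) (x y z : 'cV[R]_k).

(** An invertible positive semidefinite form is bounded below: by
    Cauchy-Schwarz for the form, |Bx|^2 is at most a constant times x^T B x,
    and |x| is at most a constant times |Bx|. *)
Lemma psd_unit_coercive B : B^T = B -> (forall z, 0 <= bil B z z) ->
  B \in unitmx -> exists2 eps, 0 < eps & forall x, eps * l2norm x ^+ 2 <= bil B x x.
Proof.
move=> sB B0 uB.
pose c : R := 1 + \sum_i \sum_j `|B i j|.
pose c' : R := 1 + \sum_i \sum_j `|invmx B i j|.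
have c0 : 0 < c by rewrite ltr_pwDl// sumr_ge0// => i _; rewrite sumr_ge0.
have c'0 : 0 < c' by rewrite ltr_pwDl// sumr_ge0// => i _; rewrite sumr_ge0.
exists (c * c' ^+ 2)^-1; first by rewrite invr_gt0 mulr_gt0// exprn_gt0.
move=> x.
rewrite mulrC ler_pdivrMr ?mulr_gt0 ?exprn_gt0//.
pose y := B *m x.
have xy : l2norm x <= c' * l2norm y.
  rewrite -[in leLHS](mulKmx uB x); apply: le_trans (mulmx_norm_le _ _) _.
  by rewrite ler_wpM2r ?l2norm_ge0// lerDr.
have yy : l2norm y ^+ 2 <= c * bil B x x.
  have [y0|y0] := eqVneq (l2norm y) 0.
    by rewrite y0 expr0n mulr_ge0// ltW.
  have yg0 : 0 < l2norm y by rewrite lt_neqAle eq_sym y0 l2norm_ge0.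
  have := psd_Cauchy_Schwarz y x sB B0.
  rewrite -bil_mulmx -/y -l2norm_sqr => h.
  have h2 : bil B y y <= c * l2norm y ^+ 2.
    apply: le_trans (ler_norm _) (le_trans (bil_le_entries _ _ _) _).
    by rewrite -expr2 ler_wpM2r ?sqr_ge0// lerDr.
  rewrite -(@ler_pM2l _ (l2norm y ^+ 2)) ?exprn_gt0//.
  rewrite -[leLHS]expr2; apply: le_trans h _.
  by rewrite [leRHS]mulrA [_ * c]mulrC ler_wpM2r.
apply: (@le_trans _ _ ((c' * l2norm y) ^+ 2)).
  by rewrite lerXn2r ?nnegrE ?l2norm_ge0// mulr_ge0 ?l2norm_ge0// ltW.
rewrite exprMn (_ : _ * (c * _) = c' ^+ 2 * (c * bil B x x)); last by ring.
by rewrite ler_wpM2l ?sqr_ge0.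
Qed.

(** The infimum of the quadratic form over the unit sphere is an eigenvalue:
    otherwise the form shifted by it would be coercive. Every eigenvalue is a
    value of the form on the sphere, so that infimum is the smallest
    eigenvalue. *)
Lemma lambda_min_le A x : A^T = A -> lambda_min A * l2norm x ^+ 2 <= bil A x x.
Proof.
move=> sA.
have [->|x0] := eqVneq x 0.
  by rewrite l2norm0 expr0n mulr0 /bil mulmx0 mxE.
pose S := [set bil A u u | u in [set u | l2norm u = 1]].
have Slb : lbound S (- \sum_i \sum_j `|A i j|).
  move=> _ [u /= u1 <-]; have := bil_le_entries A u u.
  by rewrite u1 !mulr1 ler_norml => /andP[].
have hlS : has_lbound S by exists (- \sum_i \sum_j `|A i j|).
have S0 : S !=set0.
  by exists (bil A ((l2norm x)^-1 *: x) ((l2norm x)^-1 *: x));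
    exists ((l2norm x)^-1 *: x) => //=; exact: l2norm_normalize.
pose m := inf S.
have mle u : m * l2norm u ^+ 2 <= bil A u u.
  have [->|u0] := eqVneq u 0.
    by rewrite l2norm0 expr0n mulr0 /bil mulmx0 mxE.
  have : m <= bil A ((l2norm u)^-1 *: u) ((l2norm u)^-1 *: u).
    by apply: inf_lbound => //; exists ((l2norm u)^-1 *: u) => //=; exact: l2norm_normalize.
  rewrite bilZl bilZr mulrA -expr2 exprVn mulrC ler_pdivlMr//.
  by rewrite exprn_gt0// l2norm_gt0.
have mE (a : R) (v : 'rV_k) : v != 0 -> v *m A = a *: v -> m <= a.
  move=> v0 vA; have := mle v^T.
  have vT0 : v^T != 0 by rewrite -(inj_eq trmx_inj) trmxK trmx0.
  rewrite /bil trmxK vA -scalemxAl mxE.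
  rewrite (_ : (v *m v^T) 0 0 = l2norm v^T ^+ 2); last first.
    by rewrite l2norm_sqr /bil mulmx1 trmxK.
  by rewrite ler_pM2r// exprn_gt0// l2norm_gt0.
have m_eig : eigenvalue A m.
  rewrite /eigenvalue /eigenspace kermx_eq0 row_free_unit.
  apply/negP => uB.
  have sB : (A - m%:M)^T = A - m%:M by rewrite linearB/= sA tr_scalar_mx.
  have B0 z : 0 <= bil (A - m%:M) z z.
    by rewrite bil_addmx bil_oppmx bil_scalar_mx -l2norm_sqr subr_ge0.
  have [eps eps0 epsB] := psd_unit_coercive sB B0 uB.
  suff : m + eps <= m by lra.
  apply: lb_le_inf => // _ [u /= u1 <-].
  have := epsB u.
  rewrite bil_addmx bil_oppmx bil_scalar_mx -l2norm_sqr u1 expr1n !mulr1; lra.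
apply: le_trans (mle x); rewrite ler_wpM2r ?sqr_ge0//.
apply: inf_lbound => //; exists m => a /= /eigenvalueP[v vA v0].
exact: mE v0 vA.
Qed.

End smallest_eigenvalue.

(** * Nets of the unit sphere *)

Section grid_net.
Context (R : realType) (k : nat).
Implicit Types (u x y : 'cV[R]_k).

(** A grid point is stored by the signs and the magnitudes of its
    coordinates, in units of 1 / (4 sqrt k); with this mesh, rounding moves a
    vector by at most 1/4. The sign is kept apart from the magnitude so that
    the points can be counted by a geometric series per coordinate. *)
Definition grid := {ffun 'I_k -> bool * 'I_(4 * k).+1}.

Definition grid_point (z : grid) : 'cV[R]_k :=
  \col_i ((-1) ^+ (z i).1 * (z i).2%:R / (4 * Num.sqrt k%:R)).

Definition net : {set grid} := [set z : grid | (\sum_i (z i).2 <= 4 * k)%N]%SET.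

(** Round every coordinate of u towards zero, which does not increase the
    norm; the budget 4 k on the total magnitude suffices because
    |u|_1 <= sqrt k. *)
Lemma net_covers u : (0 < k)%N -> l2norm u = 1 ->
  exists z, [/\ z \in net, l2norm (grid_point z) <= 1 &
                l2norm (u - grid_point z) <= 4^-1].
Proof.
move=> k0 u1.
have kR : 0 < k%:R :> R by rewrite ltr0n.
have sk0 : 0 < Num.sqrt k%:R :> R by rewrite sqrtr_gt0.
have k1 : 1 <= k%:R :> R by rewrite ler1n.
pose s : R := 4 * Num.sqrt k%:R.
have s0 : 0 < s by rewrite mulr_gt0.
have s2 : s ^+ 2 = 16 * k%:R by rewrite exprMn sqr_sqrtr ?ltW//; congr (_ * _); ring.
pose a i := Num.truncn (s * `|u i 0|).
have aP i : (a i)%:R <= s * `|u i 0| < (a i)%:R + 1.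
  by rewrite natr1; apply: truncn_itv; apply: mulr_ge0 => //; exact: ltW.
have a4k i : (a i < (4 * k).+1)%N.
  rewrite ltnS -(ler_nat R); apply: le_trans (andP (aP i)).1 _.
  rewrite natrM -mulrA ler_wpM2l//.
  have uj : `|u i 0| <= 1 by rewrite -u1; exact: normr_entry_le.
  apply: (@le_trans _ _ (Num.sqrt k%:R)); first by rewrite ler_piMr// (ltW sk0).
  have skk : Num.sqrt k%:R * Num.sqrt k%:R = k%:R :> R.
    by rewrite -expr2 sqr_sqrtr ?ltW.
  rewrite -[leRHS]skk ler_peMl ?(ltW sk0)//.
  by rewrite -[leLHS]sqrtr1 ler_wsqrtr.
pose z : grid := [ffun i => (u i 0 < 0, Ordinal (a4k i))].
have zE i : grid_point z i 0 = (-1) ^+ (u i 0 < 0)%R * ((a i)%:R / s).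
  by rewrite mxE ffunE /= -mulrA.
have uE i : u i 0 = (-1) ^+ (u i 0 < 0)%R * `|u i 0| by rewrite -realEsign ?num_real.
have zle i : (a i)%:R / s <= `|u i 0|.
  by rewrite ler_pdivrMr// mulrC; case/andP: (aP i).
exists z; split.
- rewrite inE; under eq_bigr => i _ do rewrite ffunE /=.
  rewrite -(ler_nat R) natr_sum.
  apply: (@le_trans _ _ (s * \sum_i `|u i 0|)).
    by rewrite mulr_sumr; apply: ler_sum => i _; case/andP: (aP i).
  have l1 : \sum_i `|u i 0| <= Num.sqrt k%:R.
    have := Cauchy_Schwarz (const_mx 1) (\col_i `|u i 0|).
    rewrite (_ : l2norm (\col_i `|u i 0|) = 1); last first.
      rewrite -u1 /l2norm; congr Num.sqrt; apply: eq_bigr => i _.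
      by rewrite mxE real_normK ?num_real.
    rewrite (_ : l2norm (const_mx 1) = Num.sqrt k%:R); last first.
      rewrite /l2norm; under eq_bigr => i _ do rewrite mxE expr1n.
      by rewrite sumr_const card_ord.
    rewrite mulr1; apply: le_trans; rewrite /bil mulmx1 mxE.
    apply: le_trans (ler_norm _); apply: ler_sum => i _.
    by rewrite !mxE mul1r.
  apply: (@le_trans _ _ (s * Num.sqrt k%:R)); first by rewrite ler_wpM2l// ltW.
  by rewrite /s -mulrA -expr2 sqr_sqrtr ?(ltW kR)// natrM.
- rewrite -u1 /l2norm ler_wsqrtr//; apply: ler_sum => i _.
  rewrite zE exprMn sqrr_sign mul1r -[u i 0 ^+ 2]real_normK ?num_real//.
  by rewrite lerXn2r ?nnegrE// divr_ge0// ltW.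
- rewrite -[leRHS]ger0_norm//.
  rewrite -ler_sqr ?nnegrE ?l2norm_ge0// sqr_sqrtr; last first.
    by apply: sumr_ge0 => i _; exact: sqr_ge0.
  apply: (@le_trans _ _ (\sum_(i < k) (s ^+ 2)^-1)); last first.
    rewrite sumr_const card_ord -[leLHS]mulr_natl s2 ger0_norm//.
    rewrite le_eqVlt; apply/orP; left; apply/eqP.
    by field; rewrite gt_eqF.
  apply: ler_sum => i _; rewrite mxE [X in _ + X]mxE zE {1}uE -mulrBr exprMn sqrr_sign mul1r.
  rewrite -exprVn lerXn2r ?nnegrE ?invr_ge0 ?subr_ge0// ?(ltW s0)//.
  have : `|u i 0| <= ((a i)%:R + 1) / s.
    by rewrite ler_pdivlMr// mulrC; case/andP: (aP i) => _ /ltW.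
  by rewrite mulrDl mul1r; lra.
Qed.

(** Weighting a grid point by 2 to the minus its total magnitude turns the
    count into a product of k geometric series. *)
Lemma card_net : (#|net|%:R <= 64 ^+ k :> R).
Proof.
pose w (z : grid) : R := \prod_i (16 * (2^-1) ^+ (z i).2).
have w0 z : 0 <= w z by apply: prodr_ge0 => i _; rewrite mulr_ge0// exprn_ge0.
apply: (@le_trans _ _ (\sum_(z in net) w z)).
  rewrite -sum1_card natr_sum; apply: ler_sum => z; rewrite inE => zk.
  rewrite /w big_split/= prodr_const card_ord.
  rewrite -expr_sum (_ : 16 = 2 ^+ 4); last by ring.
  rewrite -exprM -[X in X * _]invrK -exprVn -ler_pdivrMl ?invr_gt0 ?exprn_gt0//.
  rewrite invrK mulr1; apply: ler_wiXn2l => //; lra.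
apply: (@le_trans _ _ (\sum_z w z)).
  by rewrite big_mkcond/=; apply: ler_sum => z _; case: ifP.
rewrite /w -(bigA_distr_bigA
  (fun (i : 'I_k) (p : bool * 'I_(4 * k).+1) => 16 * (2^-1) ^+ p.2)).
rewrite prodr_const card_ord lerXn2r ?nnegrE//.
  by apply: sumr_ge0 => p _; rewrite mulr_ge0// exprn_ge0.
rewrite -mulr_sumr -(pair_bigA _ (fun (b : bool) (a : 'I_(4 * k).+1) => (2^-1) ^+ a))/=.
rewrite big_bool /=.
have := @sum_geometric_le R 2^-1 (4 * k).+1 ltac:(by apply/andP; split; lra).
rewrite (_ : (1 - 2^-1)^-1 = 2); last by field.
by move: (\sum_(_ < _) _) => b; lra.
Qed.

(** The mesh 1/4 loses at most half of the supremum of a symmetric form over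
    the sphere; polarization passes from the quadratic to the bilinear form. *)
Lemma bil_le_net D M : (0 < k)%N -> D^T = D ->
  (forall z, z \in net -> l2norm (grid_point z) <= 1 ->
     `|bil D (grid_point z) (grid_point z)| <= M) ->
  forall x y, `|bil D x y| <= 2 * M * (l2norm x * l2norm y).
Proof.
move=> k0 sD DM.
pose S := [set `|bil D u u| | u in [set u | l2norm u = 1]].
have Sub : has_ubound S.
  exists (\sum_i \sum_j `|D i j|) => _ [u /= u1 <-].
  by have := bil_le_entries D u u; rewrite u1 !mulr1.
have quad (B : R) : (forall u, l2norm u = 1 -> `|bil D u u| <= B) ->
    forall u, `|bil D u u| <= B * l2norm u ^+ 2.
  move=> HB u; have [->|u0] := eqVneq u 0.
    by rewrite l2norm0 expr0n mulr0 /bil mulmx0 mxE normr0.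
  have := HB _ (l2norm_normalize u0).
  rewrite bilZl bilZr mulrA -expr2 exprVn normrM ger0_norm ?invr_ge0 ?sqr_ge0//.
  by rewrite mulrC ler_pdivrMr// exprn_gt0// l2norm_gt0.
have polar (B : R) : (forall u, l2norm u = 1 -> `|bil D u u| <= B) ->
    forall x y, `|bil D x y| <= B * (l2norm x * l2norm y).
  move=> HB x y.
  have [->|x0] := eqVneq x 0.
    by rewrite l2norm0 mul0r mulr0 /bil trmx0 !mul0mx mxE normr0.
  have [->|y0] := eqVneq y 0.
    by rewrite l2norm0 !mulr0 /bil mulmx0 mxE normr0.
  have unit_case v w : l2norm v = 1 -> l2norm w = 1 -> `|bil D v w| <= B.
    move=> v1 w1.
    have E : 4 * bil D v w = bil D (v + w) (v + w) - bil D (v - w) (v - w).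
      rewrite -[v - w]/(v + (- w)) -[- w]scaleN1r.
      rewrite !(bilDl, bilDr) !(bilZl, bilZr) (bilC w v sD); ring.
    have N : l2norm (v + w) ^+ 2 + l2norm (v - w) ^+ 2 = 4.
      rewrite !l2norm_sqr -[v - w]/(v + (- w)) -[- w]scaleN1r.
      rewrite !(bilDl, bilDr) !(bilZl, bilZr) -!l2norm_sqr v1 w1; ring.
    rewrite -(@ler_pM2l _ 4)// -[4 in leLHS]ger0_norm// -normrM E.
    apply: le_trans (ler_normB _ _) _.
    by rewrite mulrC -N mulrDr; apply: lerD; exact: quad.
  have := unit_case _ _ (l2norm_normalize x0) (l2norm_normalize y0).
  rewrite bilZl bilZr mulrA -invfM normrM normfV [`|_ * _|]ger0_norm ?mulr_ge0 ?l2norm_ge0//.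
  move=> h; rewrite -ler_pdivrMr ?mulr_gt0 ?l2norm_gt0//.
  by rewrite mulrC.
have HB u : l2norm u = 1 -> `|bil D u u| <= sup S.
  by move=> u1; apply: ub_le_sup => //; exists u.
(* D being symmetric, u^T D u - v^T D v is (u - v)^T D (u + v) *)
have supM : sup S <= M + sup S / 2.
  apply: ge_sup.
    pose e : 'cV[R]_k := const_mx 1.
    have e0 : e != 0.
      apply/eqP => /matrixP/(_ (Ordinal k0) 0); rewrite !mxE => /eqP.
      by rewrite oner_eq0.
    exists `|bil D ((l2norm e)^-1 *: e) ((l2norm e)^-1 *: e)|.
    by exists ((l2norm e)^-1 *: e) => //=; exact: l2norm_normalize.
  move=> _ [u /= u1 <-]; have [z [zN z1 uz]] := net_covers k0 u1.
  set v := grid_point z in z1 uz.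
  have -> : bil D u u = bil D v v + bil D (u - v) (u + v).
    rewrite -[u - v]/(u + (- v)) -[- v]scaleN1r.
    by rewrite !(bilDl, bilDr) !(bilZl, bilZr) (bilC v u sD); ring.
  apply: le_trans (ler_normD _ _) _; apply: lerD; first exact: DM.
  apply: le_trans (polar _ HB _ _) _.
  have S0 : 0 <= sup S by apply: le_trans (HB u u1).
  rewrite ler_wpM2l// (_ : 2^-1 = 4^-1 * 2); last by field.
  apply: ler_pM => //; rewrite ?l2norm_ge0//.
  by apply: le_trans (l2normD _ _) _; rewrite u1; lra.
move=> x y; apply: le_trans (polar _ HB x y) _.
by rewrite ler_wpM2r ?mulr_ge0 ?l2norm_ge0//; lra.
Qed.

(** Take the net point near g / |g|. *)
Lemma l2norm_le_net (g : 'cV[R]_k) M : (0 < k)%N ->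
  (forall z, z \in net -> l2norm (grid_point z) <= 1 ->
     `|bil 1%:M (grid_point z) g| <= M) -> l2norm g <= 2 * M.
Proof.
move=> k0 gM; have [->|g0] := eqVneq g 0.
  rewrite l2norm0.
  have e1 : l2norm (delta_mx (Ordinal k0) 0 : 'cV[R]_k) = 1.
    rewrite /l2norm (bigD1 (Ordinal k0))//= big1 => [|i /negPf i0].
      by rewrite mxE !eqxx expr1n addr0 sqrtr1.
    by rewrite mxE i0 expr0n.
  have [z [zN z1 _]] := net_covers k0 e1.
  by rewrite mulr_ge0// (le_trans _ (gM z zN z1)).
have [z [zN z1 uz]] := net_covers k0 (l2norm_normalize g0).
set u := _ *: g in uz; set v := grid_point z in z1 uz.
have gu : l2norm g = bil 1%:M v g + bil 1%:M (u - v) g.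
  rewrite -bilDl addrC subrK bilZl -l2norm_sqr expr2 mulKf//.
  by rewrite gt_eqF// l2norm_gt0.
have h1 := le_trans (ler_norm _) (gM z zN z1).
have h2 := le_trans (ler_norm _) (Cauchy_Schwarz (u - v) g).
have h3 : l2norm (u - v) * l2norm g <= 4^-1 * l2norm g.
  by rewrite ler_wpM2r ?l2norm_ge0.
rewrite -/v in h1; have := l2norm_ge0 g; lra.
Qed.

End grid_net.

(** * The estimator on the good event *)

Section deterministic.
Context (R : realType).

Lemma bil_trmul n k (A : 'M[R]_(n, k)) (v : 'cV[R]_k) (w : 'cV[R]_n) :
  bil 1%:M v (A^T *m w) = \sum_i (A *m v) i 0 * w i 0.
Proof.
rewrite /bil mulmx1 mulmxA -trmx_mul mxE.
by apply: eq_bigr => i _; rewrite mxE.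
Qed.

Lemma bil_gram n k (A B : 'M[R]_(n, k)) (v w : 'cV[R]_k) :
  bil (A^T *m B) v w = \sum_i (A *m v) i 0 * (B *m w) i 0.
Proof. by rewrite -bil_mulmx -mulmxA bil_trmul. Qed.

Lemma bil_tr k (A : 'M[R]_k) (v w : 'cV[R]_k) : bil A^T v w = bil A w v.
Proof.
rewrite !bilE exchange_big/=; apply: eq_bigr => i _; apply: eq_bigr => j _.
by rewrite mxE; ring.
Qed.

Lemma coercive_unitmx k (A : 'M[R]_k) (c : R) : 0 < c ->
  (forall x, c * l2norm x ^+ 2 <= bil A x x) -> A \in unitmx.
Proof.
move=> c0 Ac; rewrite -row_free_unit -kermx_eq0; apply/negPn/negP.
move=> /rowV0Pn[r /sub_kermxP rA r0].
have := Ac r^T; rewrite /bil trmxK rA mul0mx mxE leNgt.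
rewrite mulr_gt0// exprn_gt0// l2norm_gt0.
by rewrite -(inj_eq trmx_inj) trmxK trmx0.
Qed.

Variables (n k : nat) (X W : 'M[R]_(n, k)) (e : 'cV[R]_n).
Variables (Sigma_x Sigma_w : 'M[R]_k) (beta : 'cV[R]_k).
Variables (sigma_w sigma_e tau : R).
Hypotheses (k0 : (0 < k)%N) (w0 : 0 <= sigma_w) (e0 : 0 <= sigma_e)
  (tau0 : 0 <= tau).
Hypotheses (sym_x : Sigma_x^T = Sigma_x) (sym_w : Sigma_w^T = Sigma_w).
Hypothesis lam0 : 0 < lambda_min Sigma_x.
Hypothesis small_tau : 8 * ((1 + sigma_w ^+ 2) * tau) <= lambda_min Sigma_x.

Local Notation on_net Q := (forall z : grid k, z \in net k ->
  l2norm (grid_point R z) <= 1 -> Q (grid_point R z)).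

Hypothesis Hxx : on_net (fun v => `|bil (X^T *m X - Sigma_x) v v| <= tau).
Hypothesis Hww : on_net (fun v =>
  `|bil (W^T *m W - Sigma_w) v v| <= sigma_w ^+ 2 * tau).
Hypothesis Hxw : on_net (fun v => `|bil (X^T *m W) v v| <= sigma_w * tau).
Hypothesis Hxe : on_net (fun v => `|bil 1%:M v (X^T *m e)| <= sigma_e * tau).
Hypothesis Hwe : on_net (fun v =>
  `|bil 1%:M v (W^T *m e)| <= sigma_w * sigma_e * tau).
Hypothesis Hxwb : on_net (fun v =>
  `|bil 1%:M v (X^T *m (W *m beta))| <= sigma_w * l2norm beta * tau).

Let Z := X + W.
Let Sigma_hat := Z^T *m Z - Sigma_w.

Let trZ : Z^T = X^T + W^T.
Proof. by apply/matrixP => i j; rewrite !mxE. Qed.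

Lemma Sigma_hatE : Sigma_hat = Sigma_x +
  ((X^T *m X - Sigma_x) + (W^T *m W - Sigma_w) + (X^T *m W + (X^T *m W)^T)).
Proof.
rewrite /Sigma_hat trZ /Z mulmxDl !mulmxDr trmx_mul trmxK.
apply/matrixP => i j.
by move: (X^T *m X) (X^T *m W) (W^T *m X) (W^T *m W) => A B C E; rewrite !mxE; ring.
Qed.

Lemma Sigma_hat_sym : Sigma_hat^T = Sigma_hat.
Proof. by rewrite /Sigma_hat linearB/= trmx_mul trmxK sym_w. Qed.

(** On the net the perturbation Sigma_hat - Sigma_x is at most
    (1 + 2 sigma_w + sigma_w^2) tau, so its operator norm is at most
    4 (1 + sigma_w^2) tau, half of the smallest eigenvalue of Sigma_x. *)
Lemma Sigma_hat_coercive x :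
  lambda_min Sigma_x / 2 * l2norm x ^+ 2 <= bil Sigma_hat x x.
Proof.
pose D := Sigma_hat - Sigma_x.
have DE : D = (X^T *m X - Sigma_x) + (W^T *m W - Sigma_w)
    + (X^T *m W + (X^T *m W)^T).
  by rewrite /D Sigma_hatE addrC addKr.
have symD : D^T = D by rewrite /D linearB/= Sigma_hat_sym sym_x.
have DM : on_net (fun v => `|bil D v v| <= 2 * ((1 + sigma_w ^+ 2) * tau)).
  move=> z zN z1; have := Hxx zN z1; have := Hww zN z1; have := Hxw zN z1.
  set v := grid_point R z.
  have -> : bil D v v = bil (X^T *m X - Sigma_x) v v
      + bil (W^T *m W - Sigma_w) v v + 2 * bil (X^T *m W) v v.
    by rewrite DE !bil_addmx !bil_oppmx bil_tr; ring.
  move: (bil (X^T *m X - Sigma_x) v v) (bil (W^T *m W - Sigma_w) v v) (bil (X^T *m W) v v).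
  move=> a b c hc hb ha.
  have h : 2 * sigma_w * tau <= (1 + sigma_w ^+ 2) * tau.
    by rewrite ler_wpM2r//; have := sqr_ge0 (1 - sigma_w); lra.
  move: ha hb hc; rewrite !ler_norml => /andP[? ?] /andP[? ?] /andP[? ?].
  by apply/andP; split; lra.
have := bil_le_net k0 symD DM x x.
rewrite -expr2 ler_norml => /andP[h _].
have hx := lambda_min_le x sym_x.
have -> : bil Sigma_hat x x = bil D x x + bil Sigma_x x x by rewrite -bil_addmx subrK.
have h2 : 2 * (2 * ((1 + sigma_w ^+ 2) * tau)) * l2norm x ^+ 2 <=
    lambda_min Sigma_x / 2 * l2norm x ^+ 2.
  rewrite ler_wpM2r ?sqr_ge0//.
  by have := small_tau; move: (_ * tau) (lambda_min _) => a b; lra.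
move: h hx h2; rewrite ![_ / 2 * _]mulrAC.
move: (lambda_min _ * _) (bil D x x) (bil Sigma_x x x) (_ * _ * _) => a b c f.
by lra.
Qed.

Lemma Sigma_hat_posdef : posdef Sigma_hat.
Proof.
split; first exact: Sigma_hat_sym.
move=> v v0; apply: lt_le_trans (Sigma_hat_coercive v).
by rewrite mulr_gt0 ?divr_gt0// exprn_gt0// l2norm_gt0.
Qed.

Let residual := X^T *m e + W^T *m e - X^T *m (W *m beta)
  - (W^T *m W - Sigma_w) *m beta.

(** The terms containing X^T X beta cancel, so the residual only contains
    noise. *)
Lemma normal_equation :
  Z^T *m (X *m beta + e) - Sigma_hat *m beta = residual.
Proof.
rewrite /residual /Sigma_hat !mulmxBl -!mulmxA trZ /Z !(mulmxDl, mulmxDr).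
apply/matrixP => i j.
move: (X^T *m (X *m beta)) (X^T *m (W *m beta)) (W^T *m (X *m beta))
  (W^T *m (W *m beta)) (X^T *m e) (W^T *m e) (Sigma_w *m beta) => A B C E F G H.
by rewrite !mxE; ring.
Qed.

(** The last term of the residual is estimated through the operator norm of
    W^T W - Sigma_w, the other three as vectors tested against the net. *)
Lemma residual_le : l2norm residual <=
  2 * tau * (sigma_e * (1 + sigma_w) + (sigma_w + sigma_w ^+ 2) * l2norm beta).
Proof.
have h1 := l2norm_le_net k0 Hxe.
have h2 := l2norm_le_net k0 Hwe.
have h3 := l2norm_le_net k0 Hxwb.
have symD : (W^T *m W - Sigma_w)^T = W^T *m W - Sigma_w.
  by rewrite linearB/= trmx_mul trmxK sym_w.
have h4 : l2norm ((W^T *m W - Sigma_w) *m beta)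
    <= 2 * (sigma_w ^+ 2 * tau) * l2norm beta.
  set y := _ *m beta.
  have [y0|y0] := eqVneq y 0.
    rewrite y0 l2norm0.
    by rewrite !mulr_ge0 ?l2norm_ge0 ?sqr_ge0.
  rewrite -(@ler_pM2l _ (l2norm y)) ?l2norm_gt0// -expr2 l2norm_sqr {2}/y bil_mulmx.
  apply: le_trans (ler_norm _) _; rewrite [leRHS]mulrCA.
  exact: bil_le_net.
rewrite /residual.
apply: le_trans (l2normD _ _) _; rewrite l2normN.
apply: le_trans (lerD (l2normD _ _) (lexx _)) _; rewrite l2normN.
apply: le_trans (lerD (lerD (l2normD _ _) (lexx _)) (lexx _)) _.
apply: le_trans (lerD (lerD (lerD h1 h2) h3) h4) _.
by rewrite le_eqVlt; apply/orP; left; apply/eqP; ring.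
Qed.

(** Test the equation for the error v against v itself: coercivity bounds the
    result below by lambda_min |v|^2 / 2, and Cauchy-Schwarz bounds it above by
    |v| times the residual. *)
Lemma estimator_error :
  l2norm (invmx Sigma_hat *m (Z^T *m (X *m beta + e)) - beta) <=
  8 * tau * (((sigma_w + sigma_w ^+ 2) * l2norm beta
    + sigma_e * Num.sqrt (1 + sigma_w ^+ 2)) / lambda_min Sigma_x).
Proof.
have uS : Sigma_hat \in unitmx.
  by apply: coercive_unitmx Sigma_hat_coercive; rewrite divr_gt0.
set v := _ - beta.
have Sv : Sigma_hat *m v = residual.
  by rewrite /v mulmxBr mulKVmx// normal_equation.
have vr : lambda_min Sigma_x / 2 * l2norm v <= l2norm residual.
  have [v0|v0] := eqVneq v 0.
    by rewrite v0 l2norm0 mulr0 l2norm_ge0.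
  rewrite -(@ler_pM2l _ (l2norm v)) ?l2norm_gt0// mulrCA -expr2.
  apply: le_trans (Sigma_hat_coercive v) _.
  rewrite -bil_mulmx Sv; exact: le_trans (ler_norm _) (Cauchy_Schwarz _ _).
have sq : 1 + sigma_w <= 2 * Num.sqrt (1 + sigma_w ^+ 2).
  have g0 : 0 <= Num.sqrt (1 + sigma_w ^+ 2) by exact: sqrtr_ge0.
  rewrite -ler_sqr ?nnegrE ?addr_ge0 ?mulr_ge0// exprMn sqr_sqrtr; last first.
    by rewrite addr_ge0// sqr_ge0.
  by have := sqr_ge0 (1 - sigma_w); have := sqr_ge0 sigma_w; lra.
rewrite mulrA ler_pdivlMr//.
have b0 : 0 <= (sigma_w + sigma_w ^+ 2) * l2norm beta.
  by rewrite mulr_ge0 ?l2norm_ge0// addr_ge0// sqr_ge0.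
have h : sigma_e * (1 + sigma_w) + (sigma_w + sigma_w ^+ 2) * l2norm beta <=
    2 * ((sigma_w + sigma_w ^+ 2) * l2norm beta
      + sigma_e * Num.sqrt (1 + sigma_w ^+ 2)).
  have := ler_wpM2l e0 sq; move: b0; set b := _ * l2norm beta.
  by rewrite mulrCA; move: (sigma_e * (1 + _)) (sigma_e * Num.sqrt _) => a c; lra.
have := le_trans vr residual_le.
have := ler_wpM2l (mulr_ge0 (ler0n R 2) tau0) h.
set N := _ + sigma_e * Num.sqrt _.
rewrite (_ : 2 * tau * (2 * N) = 4 * tau * N); last by ring.
by rewrite [_ / 2 * _]mulrAC [l2norm v * _]mulrC; lra.
Qed.

End deterministic.

(** * Expectations of independent random variables *)

Section independence.
Context (d : measure_display) (T : measurableType d) (R : realType).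
Variable P : probability T R.
Implicit Types (F G : set (set T)).

Lemma measurable_fun_sub d' (T' : measurableType d') F (f : T -> T') :
  F `<=` measurable ->
  measurable_fun setT (f : g_sigma_algebraType F -> T') ->
  measurable_fun setT f.
Proof.
move=> FS mf _ B mB; have := mf measurableT B mB.
apply: smallest_sub => //; exact: sigma_algebra_measurable.
Qed.

(** The hypothesis is the conclusion for indicators of events of F; both
    sides are linear in g and stable under monotone limits, so it extends to
    simple functions and then to every nonnegative F-measurable g. *)
Lemma integral_mul_factor F (h : T -> R) (c : R) (g : T -> R) :
  F `<=` measurable -> measurable_fun setT h -> (forall t, 0 <= h t) ->
  (forall E : set T, <<s F >> E ->
     (\int[P]_t (h t * \1_E t)%:E = c%:E * P E)%E) ->
  measurable_fun setT (g : g_sigma_algebraType F -> R) ->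
  (forall t, 0 <= g t) ->
  (\int[P]_t (h t * g t)%:E = c%:E * \int[P]_t (g t)%:E)%E.
Proof.
move=> FS mh h0 hE mg g0.
have sFS : <<s F >> `<=` measurable.
  by apply: smallest_sub => //; exact: sigma_algebra_measurable.
have mgE : @measurable_fun _ _ (g_sigma_algebraType F) _ setT (EFin \o g).
  exact/measurable_EFinP.
pose a := nnsfun_approx measurableT mgE.
have ma k : measurable_fun setT (a k : T -> R).
  exact: (measurable_fun_sub FS).
have a0 k t : 0 <= a k t by [].
have nda t : {homo (fun k => a k t) : k l / (k <= l)%N >-> k <= l}.
  by move=> k l kl; exact/lefP/nd_nnsfun_approx.
have ca t : (a k t)%:E @[k --> \oo] --> (g t)%:E.
  by apply: (cvg_nnsfun_approx measurableT mgE) => // x _; rewrite lee_fin.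
have step k : (\int[P]_t (h t * a k t)%:E = c%:E * \int[P]_t (a k t)%:E)%E.
  have mlev y : measurable (a k @^-1` [set y] : set T).
    by rewrite -[X in measurable X]setTI; apply: ma.
  have sFlev y : <<s F >> (a k @^-1` [set y]).
    by rewrite -[X in <<s _ >> X]setTI; exact: (measurable_funP (a k)).
  have mind y : measurable_fun setT (fun t => \1_(a k @^-1` [set y]) t : R).
    exact: measurable_indic.
  have afin : finite_set (range (a k)) by exact: fimfunP.
  transitivity (\sum_(y \in range (a k))
      \int[P]_t ((y%:E * (h t * \1_(a k @^-1` [set y]) t)%:E)))%E.
    rewrite -ge0_integral_fsum//; last 2 first.
    - move=> y; apply: measurable_funeM; apply/measurable_EFinP.
      by apply: measurable_funM => //; exact: mind.
    - move=> y t _; rewrite -EFinM lee_fin indicE.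
      have [|_] := boolP (t \in _); last by rewrite !mulr0.
      by rewrite inE/= => <-; rewrite mulr1 mulr_ge0.
    apply: eq_integral => t _.
    rewrite fimfunE fsumEFin//; congr EFin.
    rewrite mulr_fsumr//.
    by apply: eq_fsbigr => y _; rewrite mulrCA.
  transitivity (\sum_(y \in range (a k)) (c%:E * (y%:E * P (a k @^-1` [set y]))))%E.
    apply: eq_fsbigr => y; rewrite inE => -[t _ <-].
    rewrite ge0_integralZl_EFin//; last 2 first.
    - by move=> x _; rewrite lee_fin mulr_ge0.
    - by apply/measurable_EFinP/measurable_funM => //; exact: mind.
    by rewrite hE// muleCA.
  have yP0 y : (0 <= y%:E * P (a k @^-1` [set y]))%E.
    have [y0|y0] := leP 0 y; first by rewrite mule_ge0.
    rewrite (_ : _ @^-1` _ = set0) ?measure0 ?mule0//.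
    by apply/seteqP; split=> // t /= aty; have := a0 k t; rewrite aty leNgt y0.
  rewrite -ge0_mule_fsumr//; congr (_ * _)%E.
  transitivity (\int[P]_t (\sum_(y \in range (a k))
      (y * \1_(a k @^-1` [set y]) t)%:E))%E; last first.
    by apply: eq_integral => t _; rewrite fimfunE -fsumEFin.
  rewrite ge0_integral_fsum//; last 2 first.
  - move=> y; under eq_fun do rewrite EFinM.
    apply: measurable_funeM; apply/measurable_EFinP; exact: measurable_indic.
  - move=> y t _; rewrite lee_fin indicE.
    have [|_] := boolP (t \in _); last by rewrite mulr0.
    by rewrite inE/= => <-; rewrite mulr1.
  apply: eq_fsbigr => y; rewrite inE => -[t _ <-].
  under eq_integral do rewrite EFinM.
  rewrite ge0_integralZl_EFin//; last first.
    by apply/measurable_EFinP; exact: measurable_indic.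
  by rewrite integral_indic// setIT.
have lim1 : (\int[P]_t (h t * a k t)%:E)%E @[k --> \oo]
    --> (\int[P]_t (h t * g t)%:E)%E.
  have -> : (fun t => (h t * g t)%:E) = (fun t => limn (fun k => (h t * a k t)%:E)).
    apply/funext => t; apply/esym/cvg_lim => //.
    under eq_fun do rewrite EFinM.
    by rewrite EFinM; apply: cvgeZl => //; exact: ca.
  apply: cvg_monotone_convergence => //.
  - by move=> k; apply/measurable_EFinP/measurable_funM => //; exact: ma.
  - by move=> k t _; rewrite lee_fin mulr_ge0.
  - by move=> t _ k l kl; rewrite lee_fin ler_wpM2l// nda.
have lim2 : (\int[P]_t (a k t)%:E)%E @[k --> \oo] --> (\int[P]_t (g t)%:E)%E.
  have -> : (fun t => (g t)%:E) = (fun t => limn (fun k => (a k t)%:E)).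
    by apply/funext => t; apply/esym/cvg_lim.
  apply: cvg_monotone_convergence => //.
  - by move=> k; apply/measurable_EFinP; exact: ma.
  - by move=> k t _; rewrite lee_fin.
  - by move=> t _ k l kl; rewrite lee_fin nda.
apply/esym/(cvg_unique _ _ lim1) => //.
rewrite (funext step).
exact: cvgeZl.
Qed.

(** For indicators this is the definition of independence. The factors are
    turned from indicators into the general functions g i one at a time, by
    induction on the number m of factors already treated; each step is an
    instance of [integral_mul_factor], the other factors being h. *)
Lemma integral_prod_independent n (F : 'I_n -> set (set T))
    (g : 'I_n -> T -> R) :
  (forall i, sigma_algebra setT (F i)) -> (forall i, F i `<=` measurable) ->
  mutually_independent P F ->
  (forall i, @measurable_fun _ _ (g_sigma_algebraType (F i)) _ setT (g i)) ->
  (forall i t, 0 <= g i t) ->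
  (forall i, \int[P]_t (g i t)%:E < +oo)%E ->
  (\int[P]_t (\prod_i g i t)%:E = \prod_i \int[P]_t (g i t)%:E)%E.
Proof.
move=> sF FS indF mg g0 gfin.
have int_fin (f : T -> R) : (forall t, 0 <= f t) ->
    (\int[P]_t (f t)%:E < +oo)%E -> (\int[P]_t (f t)%:E)%E \is a fin_num.
  by move=> f0 ?; rewrite ge0_fin_numE ?integral_ge0// => t _; rewrite lee_fin.
suff main (m : nat) (f : 'I_n -> T -> R) : (m <= n)%N ->
    (forall i : 'I_n, (i < m)%N -> f i = g i) ->
    (forall i : 'I_n, (m <= i)%N -> exists2 E, F i E & f i = \1_E) ->
    (\int[P]_t (\prod_i f i t)%:E = \prod_i \int[P]_t (f i t)%:E)%E.
  by apply: (main n) => // i; rewrite leqNgt ltn_ord.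
elim: m f => [|m IHm] f mn fg fE.
  have /choice[E EP] : forall i, exists E, F i E /\ f i = \1_E.
    by move=> i; have [//|E ? ?] := fE i; exists E.
  have := indF [set: 'I_n]%SET E (fun i _ => (EP i).1).
  rewrite (_ : \bigcap_(i in _) E i = [set t | forall i, E i t]); last first.
    by apply/seteqP; split=> t /= Et i //; apply: Et => /=; rewrite inE.
  move=> PE.
  transitivity (P [set t | forall i, E i t]).
    rewrite -[RHS](_ : (\int[P]_t (\1_[set t | forall i, E i t] t)%:E = _)%E);
      last first.
      rewrite integral_indic ?setIT//.
      rewrite (_ : mkset _ = \bigcap_(i in [set: 'I_n]) E i); last first.
        by apply/seteqP; split=> t /= Et i //; apply: Et.
      apply: fin_bigcap_measurable => [|i _]; first exact: finite_finset.
        by exact: FS (EP i).1.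
    apply: eq_integral => t _; congr EFin; rewrite indicE.
    under eq_bigr do rewrite (EP _).2 indicE.
    have [|nE] := boolP (t \in _).
      rewrite inE /= => Et; rewrite big1// => i _.
      by rewrite mem_set.
    have /existsNP[i nEi] : ~ forall i, E i t.
      by move=> Et; move/negP: nE; apply; rewrite inE.
    by rewrite (bigD1 i)//= memNset// mul0r.
  rewrite PE; apply: eq_big => [i|i _]; first by rewrite inE.
  by rewrite (EP i).2 integral_indic ?setIT//; exact: FS (EP i).1.
(* the factor j = m is replaced by g j, and h collects the other ones *)
pose j := Ordinal mn.
pose h t := \prod_(i | i != j) f i t.
have f0 i t : 0 <= f i t.
  have [im|mi] := ltnP i m.+1; first by rewrite fg.
  by have [E _ ->] := fE _ mi; rewrite indicE.
have mf i : measurable_fun setT (f i).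
  have [im|mi] := ltnP i m.+1.
    by rewrite fg//; apply: measurable_fun_sub (mg i).
  by have [E FE ->] := fE _ mi; apply: measurable_indic; exact: FS FE.
have ffin i : (\int[P]_t (f i t)%:E < +oo)%E.
  have [im|mi] := ltnP i m.+1; first by rewrite fg.
  have [E FE ->] := fE _ mi; rewrite integral_indic ?setIT//; last exact: FS FE.
  by rewrite (le_lt_trans (probability_le1 _ _)) ?ltry//; exact: FS FE.
pose c := \prod_(i | i != j) fine (\int[P]_t (f i t)%:E)%E.
have cE : (c%:E = \prod_(i | i != j) \int[P]_t (f i t)%:E)%E.
  rewrite /c -prodEFin; apply: eq_bigr => i _.
  by rewrite fineK// int_fin.
transitivity (\int[P]_t (h t * g j t)%:E)%E.
  apply: eq_integral => t _; rewrite (bigD1 j)//= mulrC -/(h t).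
  by rewrite fg.
rewrite (@integral_mul_factor (F j) h c)//.
- by rewrite cE [RHS](bigD1 j)//= muleC fg.
- rewrite /h; under eq_fun do rewrite -big_filter.
  by apply: measurable_prod => i _; exact: mf.
- by move=> t; apply: prodr_ge0.
- move=> E; rewrite (sigma_algebra_id (sF j)) => FE.
  pose f' i := if i == j then \1_E else f i.
  have := IHm f' (ltnW mn).
  rewrite [X in _ -> _ -> X](_ : _ = ((\int[P]_t (h t * \1_E t)%:E)%E = (c%:E * P E)%E)).
    apply.
    + move=> i im; rewrite /f'; case: eqP => [ij|_]; last by rewrite fg// ltnW.
      by move: im; rewrite ij ltnn.
    + move=> i im; rewrite /f'; case: eqP => [->|/eqP ij]; first by exists E.
      apply: fE; rewrite ltn_neqAle im andbT; apply: contra_neq ij => mi.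
      exact/val_inj.
  congr (_ = _).
    apply: eq_integral => t _; rewrite (bigD1 j)//= {1}/f' eqxx mulrC; congr (_ * _)%:E.
    by apply: eq_bigr => i /negPf ij; rewrite /f' ij.
  rewrite (bigD1 j)//= {1}/f' eqxx integral_indic ?setIT//; last exact: FS FE.
  rewrite muleC cE; congr (_ * _)%E.
  by apply: eq_bigr => i /negPf ij; rewrite /f' ij.
Qed.

End independence.

Section decoupling.
Context (d : measure_display) (T : measurableType d) (R : realType).
Variable P : probability T R.
Implicit Types (F G : set (set T)).

(** The diagonal map sends P to the product of its restrictions to the two
    independent sigma-algebras, because the two measures agree on rectangles;
    Tonelli's theorem then separates the two arguments of f. *)
Lemma integral_decouple_le F G (f : T * T -> R) (h : T -> R) :
  sigma_algebra setT F -> sigma_algebra setT G ->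
  F `<=` measurable -> G `<=` measurable ->
  (forall A B, F A -> G B -> P (A `&` B) = (P A * P B)%E) ->
  @measurable_fun _ _ (g_sigma_algebraType F * g_sigma_algebraType G)%type _
    setT f ->
  (forall z, 0 <= f z) -> measurable_fun setT h ->
  (forall t, \int[P]_s (f (s, t))%:E <= (h t)%:E)%E ->
  (\int[P]_t (f (t, t))%:E <= \int[P]_t (h t)%:E)%E.
Proof.
move=> sF sG FS GS PFG mf f0 mh fh.
pose TF : measurableType _ := g_sigma_algebraType F.
pose TG : measurableType _ := g_sigma_algebraType G.
have mid H : sigma_algebra setT H -> H `<=` measurable ->
    @measurable_fun _ _ T (g_sigma_algebraType H) setT id.
  by move=> sH HS _ B; rewrite (measurable_g_measurableTypeE sH) setTI => /HS.
have mF : @measurable_fun _ _ T TF setT id by exact: mid.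
have mG : @measurable_fun _ _ T TG setT id by exact: mid.
have mD : @measurable_fun _ _ T (TF * TG)%type setT (fun t => (t, t)).
  exact: measurable_fun_pair.
pose XF : {mfun T >-> TF} := HB.pack (id : T -> TF) (isMeasurableFun.Build _ _ _ _ _ mF).
pose XG : {mfun T >-> TG} := HB.pack (id : T -> TG) (isMeasurableFun.Build _ _ _ _ _ mG).
pose XD : {mfun T >-> (TF * TG)%type} :=
  HB.pack (fun t : T => (t, t) : TF * TG) (isMeasurableFun.Build _ _ _ _ _ mD).
pose pF : probability TF R := distribution P XF.
pose pG : probability TG R := distribution P XG.
pose pD : probability (TF * TG)%type R := distribution P XD.
have mfE : measurable_fun setT (fun z : TF * TG => (f z)%:E).
  exact/measurable_EFinP.
have fE0 z : (0 <= (f z)%:E)%E by rewrite lee_fin.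
have mGf : @measurable_fun _ _ TG _ setT (fun t => \int[pF]_s (f (s, t))%:E)%E.
  exact: (@measurable_fun_fubini_tonelli_G _ _ TF TG R pF (EFin \o f)).
have pFE t : (\int[pF]_s (f (s, t))%:E = \int[P]_s (f (s, t))%:E)%E.
  rewrite (ge0_integral_distribution XF)//.
  exact: (measurableT_comp mfE (@pair2_measurable _ _ TF TG t)).
rewrite [leLHS](_ : _ = \int[pD]_z (f z)%:E)%E; last first.
  by rewrite /pD (ge0_integral_distribution XD).
rewrite [leLHS](_ : _ = \int[pF \x pG]_z (f z)%:E)%E; last first.
  apply: eq_measure_integral => A mA _; apply/esym.
  apply: product_measure_unique => // A' B' mA' mB'.
  change (P (A' `&` B') = (P A' * P B')%E).
  apply: PFG.
    by move: mA'; rewrite (measurable_g_measurableTypeE sF).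
  by move: mB'; rewrite (measurable_g_measurableTypeE sG).
rewrite fubini_tonelli2// /fubini_G.
rewrite (ge0_integral_distribution XG)//=; last first.
  by move=> t; apply: integral_ge0 => s _; exact: fE0.
apply: ge0_le_integral => //.
- by move=> t _; apply: integral_ge0 => s _; exact: fE0.
- exact: (measurable_fun_sub GS mGf).
- exact/measurable_EFinP.
- by move=> t _; rewrite pFE.
Qed.

End decoupling.

(** * Moment generating functions of squares *)

Section scalar_mgf.
Context (d : measure_display) (T : measurableType d) (R : realType).
Variable P : probability T R.
Implicit Types (v : T -> R) (s l : R).

Definition subgaussian_mgf v s : Prop := forall l,
  (\int[P]_t (expR (l * v t))%:E <= (expR (s ^+ 2 * l ^+ 2 / 2))%:E)%E.

Lemma le_integral_real (f g : T -> R) :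
  measurable_fun setT f -> measurable_fun setT g ->
  (forall t, 0 <= f t) -> (forall t, f t <= g t) ->
  (\int[P]_t (f t)%:E <= \int[P]_t (g t)%:E)%E.
Proof.
move=> mf mg f0 fg; apply: ge0_le_integral => //.
- by move=> t _; rewrite lee_fin.
- exact/measurable_EFinP.
- exact/measurable_EFinP.
- by move=> t _; rewrite lee_fin.
Qed.

Lemma measurable_expR_scale v l : measurable_fun setT v ->
  measurable_fun setT (fun t => expR (l * v t)).
Proof.
by move=> mv; apply: measurableT_comp => //; exact: measurable_funM.
Qed.


Lemma integral_expR_affine v s (a b : R) : measurable_fun setT v ->
  subgaussian_mgf v s ->
  (\int[P]_t (expR (a * v t - b))%:E
     <= (expR (s ^+ 2 * a ^+ 2 / 2 - b))%:E)%E.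
Proof.
move=> mv vs; rewrite expRD mulrC EFinM.
under eq_integral => t _ do rewrite expRD mulrC EFinM.
rewrite ge0_integralZl_EFin ?expR_ge0//; last first.
  by apply/measurable_EFinP; exact: measurable_expR_scale.
by apply: lee_wpmul2l => //; rewrite lee_fin expR_ge0.
Qed.

(** The integrand is dominated by a mixture of the exponentials
    exp (j v / s) with weights of order exp (- j^2), whereas their
    expectations are at most exp (j^2 / 2), so the series converges. *)
Lemma integral_expR_sqr_le8 v s : measurable_fun setT v -> 0 < s ->
  subgaussian_mgf v s -> (\int[P]_t (expR ((v t / s) ^+ 2 / 4))%:E <= 8%:E)%E.
Proof.
move=> mv s0 vs.
pose f (j : nat) t : R := 4 / 3 * (expR (j%:R / s * v t - j%:R ^+ 2) +
  expR (- j%:R / s * v t - j%:R ^+ 2)).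
have mterm (a b : R) : measurable_fun setT (fun t => expR (a * v t - b)).
  apply: measurableT_comp => //; apply: measurable_funB => //.
  exact: measurable_funM.
have f0 j t : 0 <= f j t by rewrite mulr_ge0// addr_ge0// expR_ge0.
have mf j : measurable_fun setT (f j).
  by apply: measurable_funM => //; apply: measurable_funD.
have term j (a : R) : a ^+ 2 = j%:R ^+ 2 ->
    (\int[P]_t (expR (a / s * v t - j%:R ^+ 2))%:E <= ((2 / 3) ^+ j)%:E)%E.
  move=> aj; apply: le_trans (integral_expR_affine _ _ mv vs) _.
  rewrite lee_fin expr_div_n aj.
  rewrite (_ : _ - _ = j%:R ^+ 2 * (- 2^-1)); last by field; rewrite gt_eqF.
  apply: (@le_trans _ _ (expR (j%:R * - 2^-1))).
    rewrite ler_expR ler_wnM2r ?oppr_le0//.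
    by rewrite -natrX ler_nat; case: (j) => // k; rewrite expnS leq_pmulr// expn_gt0.
  rewrite expRM_natl; apply: lerXn2r; rewrite ?nnegrE ?expR_ge0//.
  exact: expRN_half_le.
have fint j : (\int[P]_t (f j t)%:E <= (8 / 3 * (2 / 3) ^+ j)%:E)%E.
  under eq_integral => t _ do rewrite /f EFinM EFinD.
  rewrite ge0_integralZl_EFin//; last 2 first.
  - by move=> t _; rewrite adde_ge0// lee_fin expR_ge0.
  - by apply: emeasurable_funD; apply/measurable_EFinP.
  rewrite ge0_integralD//; last 2 first.
  - exact/measurable_EFinP.
  - exact/measurable_EFinP.
  rewrite (_ : 8 / 3 * _ = 4 / 3 * ((2 / 3) ^+ j + (2 / 3) ^+ j)); last first.
    by move: (_ ^+ j) => q; field.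
  rewrite [leRHS]EFinM; apply: lee_wpmul2l; first by rewrite lee_fin.
  by rewrite EFinD; apply: leeD; apply: term; rewrite ?sqrrN.
apply: (@le_trans _ _ (\int[P]_t (\sum_(j <oo) (f j t)%:E))%E).
  apply: ge0_le_integral => //.
  - apply/measurable_EFinP; apply: measurableT_comp => //.
    apply: measurable_funM => //; apply: measurable_funX.
    exact: measurable_funM.
  - apply: ge0_emeasurable_sum => [j t _ _|j _]; first by rewrite lee_fin.
    exact/measurable_EFinP.
  - move=> t _; have [j hj] := expR_sqr_le_discrete (v t / s).
    apply: (@le_trans _ _ (f j t)%:E).
      rewrite lee_fin (le_trans hj)// /f.
      by rewrite !mulrA ![_ / s * _]mulrAC.
    apply: le_trans (nneseries_lim_ge j.+1 _); last by move=> ? _ _; rewrite lee_fin.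
    by rewrite big_nat_recr//= leeDr// sume_ge0// => i _; rewrite lee_fin.
rewrite integral_nneseries//; last 2 first.
- by move=> j; apply/measurable_EFinP.
- by move=> j t _; rewrite lee_fin.
apply: lime_le.
  by apply: is_cvg_nneseries => j _ _; apply: integral_ge0 => t _; rewrite lee_fin.
apply: nearW => n.
apply: (@le_trans _ _ (\sum_(0 <= j < n) (8 / 3 * (2 / 3) ^+ j)%:E)%E).
  by apply: lee_sum => j _.
rewrite sumEFin lee_fin -mulr_sumr big_mkord.
have := @sum_geometric_le R (2 / 3) n ltac:(by apply/andP; split; lra).
rewrite (_ : (1 - 2 / 3)^-1 = 3); last by field.
by move: (\sum_(_ < _) _) => b; lra.
Qed.


Lemma ge0_integrable_real (f : T -> R) : measurable_fun setT f ->
  (forall t, 0 <= f t) -> (\int[P]_t (f t)%:E < +oo)%E ->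
  P.-integrable setT (EFin \o f).
Proof.
move=> mf f0 foo; apply/integrableP; split; first exact/measurable_EFinP.
by under eq_integral => t _ do rewrite /= (ger0_norm (f0 t)).
Qed.

(** From (l v)^2 <= 2 (exp (l v) + exp (- l v)), with l = 1 / s. When s = 0
    every l is allowed, and letting it grow forces the integral to vanish. *)
Lemma integral_sqr_le v s : measurable_fun setT v -> 0 <= s -> subgaussian_mgf v s ->
  (\int[P]_t (v t ^+ 2)%:E <= (8 * s ^+ 2)%:E)%E.
Proof.
move=> mv s0 vs.
have msq : measurable_fun setT (fun t => v t ^+ 2) by exact: measurable_funX.
have bnd l : ((l ^+ 2)%:E * \int[P]_t (v t ^+ 2)%:E
    <= (4 * expR (s ^+ 2 * l ^+ 2 / 2))%:E)%E.
  rewrite -ge0_integralZl_EFin ?sqr_ge0//; last 2 first.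
  - by move=> t _; rewrite lee_fin sqr_ge0.
  - exact/measurable_EFinP.
  apply: (@le_trans _ _ (\int[P]_t (2 * (expR (l * v t) + expR ((- l) * v t)))%:E)%E).
    under eq_integral => t _ do rewrite -EFinM.
    apply: le_integral_real.
    - exact: measurable_funM.
    - by apply: measurable_funM => //; apply: measurable_funD;
        exact: measurable_expR_scale.
    - by move=> t; rewrite mulr_ge0// sqr_ge0.
    - by move=> t; rewrite -exprMn mulNr sqr_le_cosh.
  under eq_integral => t _ do rewrite EFinM [(expR _ + _)%:E]EFinD.
  have mexp a : measurable_fun setT (fun t => (expR (a * v t))%:E).
    by apply/measurable_EFinP; exact: measurable_expR_scale.
  rewrite ge0_integralZl_EFin//; last 2 first.
  - by move=> t _; rewrite adde_ge0// lee_fin expR_ge0.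
  - exact: emeasurable_funD.
  rewrite ge0_integralD//.
  rewrite (_ : 4 * _ = 2 * (expR (s ^+ 2 * l ^+ 2 / 2) + expR (s ^+ 2 * l ^+ 2 / 2))); last first.
    by move: (expR _) => a; ring.
  rewrite [leRHS]EFinM; apply: lee_wpmul2l => //.
  rewrite [leRHS]EFinD; apply: leeD; first exact: vs.
  by have := vs (- l); rewrite sqrrN.
have : (\int[P]_t (v t ^+ 2)%:E \is a fin_num)%E.
  rewrite ge0_fin_numE; last by apply: integral_ge0 => t _; rewrite lee_fin sqr_ge0.
  by have := bnd 1; rewrite expr1n mul1e => /le_lt_trans; apply; rewrite ltry.
have : (0 <= \int[P]_t (v t ^+ 2)%:E)%E.
  by apply: integral_ge0 => t _; rewrite lee_fin sqr_ge0.
move: (\int[P]_t _)%E bnd => [x| |]// bnd x0 _.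
have {}bnd l : l ^+ 2 * x <= 4 * expR (s ^+ 2 * l ^+ 2 / 2).
  by have := bnd l; rewrite -EFinM lee_fin.
rewrite lee_fin in x0; rewrite lee_fin.
have [s0'|s_neq0] := eqVneq s 0.
  rewrite s0' expr0n/= mulr0 leNgt; apply/negP => xgt0.
  have := bnd (Num.sqrt (5 / x)).
  rewrite s0' expr0n/= !mul0r expR0 mulr1 sqr_sqrtr ?divr_ge0//.
  by rewrite divfK ?gt_eqF// => ?; lra.
have {}s0 : 0 < s by rewrite lt_neqAle eq_sym s_neq0.
have := bnd s^-1.
rewrite -exprMn mulfV// expr1n mul1r => h.
have {}h : s^-1 ^+ 2 * x <= 8.
  by apply: le_trans h _; have := @expR_half_le2 R; lra.
by rewrite -ler_pdivrMr ?exprn_gt0// mulrC -exprVn.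
Qed.

(** In the second-order expansion of the exponential, the first-order term
    integrates to zero because m is the mean of the square, and the remainder
    is absorbed by exp (v^2 / (4 s^2)), which is integrable; the condition on
    l ensures that the remainder grows no faster. When s = 0 both v and m
    vanish. *)
Lemma mgf_centered_sqr v s m l : measurable_fun setT v -> 0 <= s ->
  subgaussian_mgf v s -> (\int[P]_t (v t ^+ 2)%:E)%E = m%:E ->
  `|l| * s ^+ 2 <= 8^-1 ->
  (\int[P]_t (expR (l * (v t ^+ 2 - m)))%:E
     <= (expR (2 ^+ 14 * l ^+ 2 * s ^+ 4))%:E)%E.
Proof.
move=> mv s0 vs mE ls.
have msq : measurable_fun setT (fun t => v t ^+ 2) by exact: measurable_funX.
have sq0 t : 0 <= v t ^+ 2 by exact: sqr_ge0.
have m0 : 0 <= m.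
  by rewrite -lee_fin -mE; apply: integral_ge0 => t _; rewrite lee_fin.
have m8 : m <= 8 * s ^+ 2 by rewrite -lee_fin -mE; exact: integral_sqr_le.
have mexp : measurable_fun setT (fun t => expR (l * (v t ^+ 2 - m))).
  apply: measurableT_comp => //; apply: measurable_funM => //.
  exact: measurable_funB.
have [s_eq0|s_neq0] := eqVneq s 0.
  have m_eq0 : m = 0 by apply/eqP; rewrite eq_le m0 andbT (le_trans m8)// s_eq0 expr0n mulr0.
  have /ae_eq_integral_abs : measurable_fun setT (fun t => (v t ^+ 2)%:E).
    exact/measurable_EFinP.
  move=> /(_ P measurableT)[+ _].
  under eq_integral => t _ do rewrite gee0_abs ?lee_fin//.
  rewrite mE m_eq0 => /(_ erefl) ae0; rewrite m_eq0 in mexp.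
  rewrite s_eq0 (_ : 0 ^+ 4 = 0) ?expr0n// mulr0 expR0.
  rewrite (@ge0_ae_eq_integral _ _ _ P setT _ (cst 1%E))//; last 2 first.
  - exact/measurable_EFinP.
  - apply: filterS ae0 => t /(_ Logic.I) [vt] _.
    by rewrite vt subr0 mulr0 expR0.
  by rewrite integral_cst//= probability_setT mule1.
have sgt0 : 0 < s by rewrite lt_neqAle eq_sym s_neq0.
(* in units of s: with w = v / s and q = w^2 + 8, the exponent z satisfies
   |z| <= L q, and q^2 <= 128 exp (q / 8) *)
pose L := `|l| * s ^+ 2.
have L0 : 0 <= L by rewrite mulr_ge0// sqr_ge0.
have L8 : L <= 8^-1 by [].
pose B := 2 ^+ 11 * L ^+ 2.
pose E4 t := expR ((v t / s) ^+ 2 / 4).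
have B0 : 0 <= B by rewrite mulr_ge0// ?sqr_ge0// exprn_ge0.
have pt t : expR (l * (v t ^+ 2 - m)) <= 1 + l * (v t ^+ 2 - m) + B * E4 t.
  apply: le_trans (expR_le_quadratic _) _; rewrite lerD2l.
  set z := l * _; pose q := (v t / s) ^+ 2 + 8.
  have q8 : 8 <= q by rewrite lerDr sqr_ge0.
  have zq : `|z| <= L * q.
    rewrite normrM -/L /L -mulrA; apply: ler_wpM2l => //.
    rewrite /q mulrDr expr_div_n mulrCA divff ?mulr1 ?expf_neq0//.
    apply: le_trans (ler_normB _ _) _.
    by rewrite !ger0_norm// lerD// mulrC.
  have e1 : expR `|z| <= expR (q / 8).
    by rewrite ler_expR (le_trans zq)// mulrC ler_wpM2l//; lra.
  have z2 : z ^+ 2 <= L ^+ 2 * q ^+ 2.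
    by rewrite -exprMn -real_normK ?num_real// lerXn2r ?nnegrE// mulr_ge0//; lra.
  have q2 : q ^+ 2 <= 128 * expR (q / 8).
    have := @sqr_le_expR R (q / 8); rewrite expr_div_n => h.
    have {}h := h ltac:(lra).
    by move: h; set a := expR _; set b := q ^+ 2; lra.
  have e2 : expR (q / 8) * expR (q / 8) <= 16 * E4 t.
    rewrite -expRD (_ : _ + _ = (v t / s) ^+ 2 / 4 + 4%:R * 2^-1); last by rewrite /q; field.
    rewrite expRD expRM_natl -/(E4 t) mulrC ler_wpM2r ?expR_ge0//.
    apply: (@le_trans _ _ (2 ^+ 4)); last by lra.
    by rewrite lerXn2r ?nnegrE ?expR_ge0// expR_half_le2.
  apply: (@le_trans _ _ (L ^+ 2 * q ^+ 2 * expR (q / 8))).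
    by apply: ler_pM; rewrite ?sqr_ge0 ?expR_ge0.
  apply: (@le_trans _ _ (L ^+ 2 * (128 * expR (q / 8)) * expR (q / 8))).
    by rewrite ler_wpM2r ?expR_ge0// ler_wpM2l ?sqr_ge0.
  rewrite (_ : _ * _ * _ = L ^+ 2 * 128 * (expR (q / 8) * expR (q / 8))); last by ring.
  rewrite (_ : B * _ = L ^+ 2 * 128 * (16 * E4 t)); last by rewrite /B; ring.
  by rewrite ler_wpM2l// mulr_ge0// sqr_ge0.
have mE4 : measurable_fun setT E4.
  apply: measurableT_comp => //; apply: measurable_funM => //.
  by apply: measurable_funX; exact: measurable_funM.
have E40 t : 0 <= E4 t by exact: expR_ge0.
have iE4le : (\int[P]_t (E4 t)%:E <= 8%:E)%E by exact: integral_expR_sqr_le8.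
have iE4 : P.-integrable setT (EFin \o E4).
  by apply: ge0_integrable_real => //; apply: le_lt_trans iE4le _; rewrite ltry.
have isq : P.-integrable setT (EFin \o (fun t => v t ^+ 2)).
  by apply: ge0_integrable_real => //; rewrite mE ltry.
have icst (a : R) : P.-integrable setT (EFin \o cst a).
  exact: finite_measure_integrable_cst.
apply: (@le_trans _ _ (\int[P]_t (1 + l * (v t ^+ 2 - m) + B * E4 t)%:E)%E).
  apply: le_integral_real => //.
  apply: measurable_funD; last exact: measurable_funM.
  apply: measurable_funD => //; apply: measurable_funM => //.
  exact: measurable_funB.
apply: (@le_trans _ _ ((1 - l * m)%:E + l%:E * m%:E + B%:E * 8%:E)%E); last first.
  rewrite -!EFinM -!EFinD lee_fin subrK.
  apply: le_trans (expR_ge1Dx _); rewrite lerD2l /B /L exprMn real_normK ?num_real//.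
  by rewrite le_eqVlt; apply/orP; left; apply/eqP; ring.
under eq_integral => t _.
  rewrite (_ : 1 + _ + _ = (1 - l * m) + l * (v t ^+ 2) + B * E4 t); last by ring.
  rewrite !EFinD EFinM [(B * _)%:E]EFinM; over.
rewrite integralD//; last 2 first.
- apply: integrableD => //; first exact: icst.
  exact: (integrableZl measurableT l isq).
- exact: (integrableZl measurableT B iE4).
rewrite integralD//; last 2 first.
- exact: icst.
- exact: (integrableZl measurableT l isq).
rewrite (integralZl measurableT isq) (integralZl measurableT iE4) mE.
rewrite integral_cst//= probability_setT mule1.
by apply: leeD => //; apply: lee_wpmul2l.
Qed.

(** The mean of the square, at most 8 s^2, is absorbed into the exponent. *)
Lemma mgf_sqr v s mu : measurable_fun setT v -> 0 <= s -> subgaussian_mgf v s ->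
  0 <= mu -> mu * s ^+ 2 <= 8^-1 ->
  (\int[P]_t (expR (mu * v t ^+ 2))%:E <= (expR (2 ^+ 12 * mu * s ^+ 2))%:E)%E.
Proof.
move=> mv s0 vs mu0 mus.
pose m := fine (\int[P]_t (v t ^+ 2)%:E)%E.
have h := integral_sqr_le mv s0 vs.
have mE : (\int[P]_t (v t ^+ 2)%:E)%E = m%:E.
  rewrite /m fineK// ge0_fin_numE ?(le_lt_trans h)// ?ltry//.
  by apply: integral_ge0 => t _; rewrite lee_fin sqr_ge0.
have m8 : m <= 8 * s ^+ 2 by rewrite -lee_fin -mE.
under eq_integral => t _.
  rewrite (_ : mu * v t ^+ 2 = mu * m + mu * (v t ^+ 2 - m)); last by ring.
  rewrite expRD EFinM; over.
rewrite ge0_integralZl_EFin ?expR_ge0//; last first.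
  apply/measurable_EFinP/measurableT_comp => //; apply: measurable_funM => //.
  by apply: measurable_funB => //; exact: measurable_funX.
apply: (@le_trans _ _ ((expR (mu * m))%:E * (expR (2 ^+ 14 * mu ^+ 2 * s ^+ 4))%:E)%E).
  apply: lee_wpmul2l; first by rewrite lee_fin expR_ge0.
  by apply: mgf_centered_sqr => //; rewrite ger0_norm.
rewrite -EFinM -expRD lee_fin ler_expR.
have h1 : mu * m <= 8 * (mu * s ^+ 2) by rewrite mulrCA ler_wpM2l.
have h2 : mu ^+ 2 * s ^+ 4 <= 8^-1 * (mu * s ^+ 2).
  rewrite (_ : mu ^+ 2 * s ^+ 4 = (mu * s ^+ 2) * (mu * s ^+ 2)); last by ring.
  by rewrite ler_wpM2r// mulr_ge0// sqr_ge0.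
have h3 : 0 <= mu * s ^+ 2 by rewrite mulr_ge0// sqr_ge0.
rewrite -[2 ^+ 14 * _ * _]mulrA -[2 ^+ 12 * _ * _]mulrA.
by move: (mu * m) (mu ^+ 2 * _) (mu * s ^+ 2) h1 h2 h3 => a b c; lra.
Qed.

End scalar_mgf.

(** * Rows of a sub-Gaussian matrix *)

Section borel_matrices.
Context (d : measure_display) (T : measurableType d) (R : realType).

Lemma sigma_algebra_sigma_of m q (V : T -> 'M[R]_(m, q)) :
  sigma_algebra setT (sigma_of V).
Proof.
have := @sigma_algebra_preimage T _ (@borel_mx R m q) setT V
  (smallest_sigma_algebra _ _).
congr (sigma_algebra _ _); apply/seteqP; split=> A [B mB <-]; exists B => //.
- by rewrite setTI.
- by rewrite setTI.
Qed.

Lemma sigma_of_measurable m q (V : T -> 'M[R]_(m, q)) :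
  random_mx V -> sigma_of V `<=` measurable.
Proof. by move=> rV A [B mB <-]; exact: rV. Qed.

Lemma borel_mx_preimage m q m' q' (f : 'M[R]_(m, q) -> 'M[R]_(m', q')) B :
  continuous f -> borel_mx B -> borel_mx (f @^-1` B).
Proof.
move=> cf; move: B; apply: smallest_sub => /=.
  have [b0 bC bU] := smallest_sigma_algebra setT [set A : set 'M[R]_(m, q) | open A].
  split => [|A bA|F bF] /=.
  - by rewrite preimage_set0.
  - by rewrite setTD preimage_setC -setTD; exact: bC.
  - by rewrite preimage_bigcup; exact: bU.
move=> B /= oB; apply: sub_sigma_algebra => /=.
by apply: open_comp => // x _; exact: cf.
Qed.

Lemma sigma_of_comp m q m' q' (f : 'M[R]_(m, q) -> 'M[R]_(m', q'))
    (V : T -> 'M[R]_(m, q)) :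
  continuous f -> sigma_of (f \o V) `<=` sigma_of V.
Proof.
move=> cf A [B mB <-]; exists (f @^-1` B) => //; exact: borel_mx_preimage.
Qed.

Lemma measurable_sigma_of m q (V : T -> 'M[R]_(m, q)) (f : 'M[R]_(m, q) -> R) :
  continuous f ->
  @measurable_fun _ _ (g_sigma_algebraType (sigma_of V)) _ setT (f \o V).
Proof.
move=> cf; apply: (measurability _ (RGenOInfty.measurableE R)) => /=.
move=> _ [_ [x ->] <-]; rewrite setTI; apply: sub_sigma_algebra.
exists (f @^-1` `]x, +oo[) => //.
apply: sub_sigma_algebra => /=.
by apply: open_comp => [y _|]; [exact: cf|exact: interval_open].
Qed.

Lemma continuous_row m q (i : 'I_m) : continuous (@row R m q i).
Proof.
move=> M A [Q MQ QA].
exists (fun i' j => if i' == i then Q 0 j else setT) => [i' j|N QN].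
  case: eqP => [->|_]; last exact: filterT.
  by have := MQ 0 j; rewrite mxE.
apply: QA => i' j; rewrite ord1 mxE.
by have := QN i j; rewrite eqxx.
Qed.

Lemma measurable_mulmx_col m q (V : T -> 'M[R]_(m, q)) (u : 'cV[R]_q) i :
  @measurable_fun _ _ (g_sigma_algebraType (sigma_of V)) _ setT
    (fun t => (V t *m u) i 0).
Proof.
under eq_fun do rewrite mxE.
apply: measurable_sum => j; apply: measurable_funM => //.
by apply: (measurable_sigma_of (f := fun M => M i j)); exact: coord_continuous.
Qed.

End borel_matrices.

Section row_moments.
Context (d : measure_display) (T : measurableType d) (R : realType).
Variable P : probability T R.
Context (n q : nat) (V : T -> 'M[R]_(n, q)) (Sigma : 'M[R]_q) (a : R).
Hypothesis sgV : sub_gaussian_mx P V Sigma a.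

Let rV : random_mx V. Proof. by case: sgV. Qed.

Lemma measurable_row (u : 'cV[R]_q) i :
  measurable_fun setT (fun t => (V t *m u) i 0).
Proof.
apply: (@measurable_fun_sub _ _ _ _ (sigma_of V)).
  exact: sigma_of_measurable.
exact: measurable_mulmx_col.
Qed.

(** The definition speaks of unit vectors only; other directions follow by
    scaling the tilt, and every scale below the maximal one is weakened to
    it. *)
Lemma row_mgf (u : 'cV[R]_q) i :
  subgaussian_mgf P (fun t => (V t *m u) i 0) ((Num.sqrt n%:R)^-1 * (a * l2norm u)).
Proof.
have [->|u0] := eqVneq u 0.
  move=> l; under eq_integral => t _ do rewrite mulmx0 mxE mulr0 expR0.
  rewrite integral_cst//= probability_setT mule1 lee_fin.
  by rewrite -expR0 ler_expR mulr_ge0// mulr_ge0// sqr_ge0.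
have nu0 : 0 < l2norm u by rewrite l2norm_gt0.
have u1 := l2norm_normalize u0.
case: sgV => _ _ _ _ /(_ i _ u1)[s [s0 sa [_ _ sgu]]] l.
have := sgu (l * l2norm u); rewrite /mmt_gen_fun unlock /= => h.
apply: le_trans (le_trans h _).
  rewrite le_eqVlt; apply/orP; left; apply/eqP; apply: eq_integral => t _.
  congr (expR _)%:E; rewrite -row_mul [in RHS]mxE -scalemxAr [in RHS]mxE.
  by field; rewrite gt_eqF.
have s2 : s ^+ 2 <= ((Num.sqrt n%:R)^-1 * a) ^+ 2.
  by rewrite lerXn2r ?nnegrE// (le_trans s0).
rewrite lee_fin ler_expR ler_pM2r//.
rewrite exprMn mulrCA [leRHS](_ : _ =
  l ^+ 2 * (((Num.sqrt n%:R)^-1 * a) ^+ 2 * l2norm u ^+ 2)); last by ring.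
by rewrite ler_wpM2l ?sqr_ge0// ler_wpM2r ?sqr_ge0.
Qed.

(** Squares of entries are nonnegative with a finite integral, and they
    dominate the products. *)
Lemma integral_entry_mul i j l :
  P.-integrable setT (EFin \o (fun t => V t i j * V t i l)) /\
  (\int[P]_t (V t i j * V t i l)%:E = (n%:R^-1 * Sigma j l)%:E)%E.
Proof.
have mV k : measurable_fun setT (fun t => V t i k).
  apply: (@measurable_fun_sub _ _ _ _ (sigma_of V)).
    exact: sigma_of_measurable.
  by apply: (measurable_sigma_of (f := fun M => M i k)); exact: coord_continuous.
have E k k' : (\int[P]_t (V t i k * V t i k')%:E = (n%:R^-1 * Sigma k k')%:E)%E.
  by case: sgV => _ _ _ /(_ i k k') + _; rewrite unlock.
split => //.
have sqi k : P.-integrable setT (EFin \o (fun t => V t i k ^+ 2)).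
  apply: ge0_integrable_real => [|t|]; first exact: measurable_funX.
  - exact: sqr_ge0.
  - by under eq_integral => t _ do rewrite expr2; rewrite E ltry.
apply: (le_integrable measurableT _ _ (integrableD measurableT (sqi j) (sqi l))).
- by apply/measurable_EFinP; exact: measurable_funM.
- move=> t _ /=; rewrite lee_fin [leRHS]ger0_norm ?addr_ge0 ?sqr_ge0//.
  rewrite normrM -[V t i j ^+ 2]real_normK ?num_real//.
  rewrite -[V t i l ^+ 2]real_normK ?num_real//.
  have := normr_ge0 (V t i j); have := normr_ge0 (V t i l).
  by move: `|V t i j| `|V t i l| => x y; nra.
Qed.

Lemma row_second_moment (u : 'cV[R]_q) i :
  (\int[P]_t ((V t *m u) i 0 ^+ 2)%:E
     = (n%:R^-1 * (u^T *m Sigma *m u) 0 0)%:E)%E.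
Proof.
transitivity (\int[P]_t (\sum_l \sum_j
    (u j 0 * u l 0)%:E * (V t i j * V t i l)%:E))%E.
  apply: eq_integral => t _; rewrite mxE expr2 big_distrlr/= exchange_big/=.
  rewrite -sumEFin; apply: eq_bigr => l _; rewrite -sumEFin.
  by apply: eq_bigr => j _; rewrite -EFinM; congr EFin; ring.
have int1 l j : P.-integrable setT
    (fun t => (u j 0 * u l 0)%:E * (V t i j * V t i l)%:E)%E.
  by apply: integrableZl => //; exact: (integral_entry_mul i j l).1.
rewrite integral_sum//; last by move=> l; apply: integrable_sum.
under eq_bigr => l _.
  rewrite integral_sum//.
  under eq_bigr => j _.
    rewrite (integralZl measurableT (integral_entry_mul i j l).1).
    rewrite /= (integral_entry_mul i j l).2 -EFinM; over.
  rewrite sumEFin; over.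
rewrite sumEFin; congr EFin; rewrite mxE mulr_sumr.
apply: eq_bigr => l _; rewrite mxE mulr_suml mulr_sumr.
by apply: eq_bigr => j _; rewrite mxE; ring.
Qed.

End row_moments.

(** * Bernstein bounds for sums over rows *)

Section bernstein.
Context (d : measure_display) (T : measurableType d) (R : realType).
Variable P : probability T R.

(** The behaviour of a sum of n independent centred terms of size K / n: the
    exponent is quadratic in l, with variance proxy K^2 / n, up to the
    threshold n / K where the terms lose their exponential moments. *)
Definition bernstein_mgf (n : nat) (S : T -> R) (K : R) : Prop :=
  measurable_fun setT S /\ forall l, `|l| * K <= 8^-1 * n%:R ->
  (\int[P]_t (expR (l * S t))%:E <= (expR (2 ^+ 14 * l ^+ 2 * K ^+ 2 / n%:R))%:E)%E.

Lemma integral_expR_sum_rows n q (V : T -> 'M[R]_(n, q)) (f : 'I_n -> T -> R)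
    (b : 'I_n -> R) :
  random_mx V ->
  mutually_independent P (fun i : 'I_n => sigma_of (fun t => row i (V t))) ->
  (forall i, @measurable_fun _ _
     (g_sigma_algebraType (sigma_of (fun t => row i (V t)))) _ setT (f i)) ->
  (forall i, \int[P]_t (expR (f i t))%:E <= (expR (b i))%:E)%E ->
  (\int[P]_t (expR (\sum_i f i t))%:E <= (expR (\sum_i b i))%:E)%E.
Proof.
move=> rV indV mf fb.
under eq_integral => t _ do rewrite expR_sum.
rewrite (@integral_prod_independent _ _ _ P _ _ (fun i t => expR (f i t)) _ _ indV).
- rewrite expR_sum -prodEFin.
  have : (0 <= \prod_(i < n) \int[P]_t (expR (f i t))%:E)%E /\
    (\prod_(i < n) \int[P]_t (expR (f i t))%:E <= \prod_(i < n) (expR (b i))%:E)%E.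
    elim/big_ind2 : _ => [|x1 x2 y1 y2 [x0 x12] [y0 y12]|i _]; first by [].
      by split; [exact: mule_ge0|exact: lee_pmul].
    by split => //; apply: integral_ge0 => t _; rewrite lee_fin expR_ge0.
  by case.
- by move=> i; exact: sigma_algebra_sigma_of.
- move=> i; apply: subset_trans (sigma_of_measurable rV).
  exact: (sigma_of_comp (f := @row R n q i) (@continuous_row _ _ _ i)).
- move=> i; exact: (measurableT_comp (@measurable_expR R) (mf i)).
- by move=> i t; exact: expR_ge0.
- by move=> i; apply: le_lt_trans (fb i) _; rewrite ltry.
Qed.

Lemma measurable_row_sigma n q (V : T -> 'M[R]_(n, q)) (u : 'cV[R]_q) i :
  @measurable_fun _ _ (g_sigma_algebraType (sigma_of (fun t => row i (V t))))
    _ setT (fun t => (V t *m u) i 0).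
Proof.
have -> : (fun t => (V t *m u) i 0) = (fun t => (row i (V t) *m u) 0 0).
  by apply/funext => t; rewrite -row_mul [RHS]mxE.
exact: (@measurable_mulmx_col _ T R 1 q (fun t => row i (V t)) u 0).
Qed.

(** The i-th row contributes a centred square at scale s with s^2 = K / n. *)
Lemma bernstein_quadratic n q (V : T -> 'M[R]_(n, q)) Sigma (a : R) (u : 'cV[R]_q) :
  (0 < n)%N -> 0 <= a -> sub_gaussian_mx P V Sigma a ->
  bernstein_mgf n
    (fun t => \sum_i (V t *m u) i 0 ^+ 2 - (u^T *m Sigma *m u) 0 0)
    (a ^+ 2 * l2norm u ^+ 2).
Proof.
move=> n0 a0 sgV; have nR : 0 < n%:R :> R by rewrite ltr0n.
have rV : random_mx V by case: sgV.
set K := a ^+ 2 * _.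
pose s := (Num.sqrt n%:R)^-1 * (a * l2norm u).
have s0 : 0 <= s by rewrite mulr_ge0 ?invr_ge0 ?sqrtr_ge0// mulr_ge0// sqrtr_ge0.
have s2 : s ^+ 2 = K / n%:R.
  by rewrite /s exprMn exprVn sqr_sqrtr ?ler0n// exprMn mulrC.
split.
  apply: measurable_funB => //; apply: measurable_sum => i.
  by apply: measurable_funX; exact: (measurable_row sgV).
move=> l lK; set m := (_ *m u) 0 0.
have SE t : l * (\sum_i (V t *m u) i 0 ^+ 2 - m) =
    \sum_(i < n) l * ((V t *m u) i 0 ^+ 2 - n%:R^-1 * m).
  rewrite -mulr_sumr sumrB; congr (_ * (_ - _)).
  by rewrite sumr_const card_ord -[RHS]mulr_natl mulVKf// gt_eqF.
under eq_integral => t _ do rewrite SE.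
apply: le_trans (integral_expR_sum_rows (b := fun=> 2 ^+ 14 * l ^+ 2 * s ^+ 4) rV _ _ _) _.
- by case: sgV.
- move=> i; apply: measurable_funM => //; apply: measurable_funB => //.
  by apply: measurable_funX; exact: measurable_row_sigma.
- move=> i; apply: mgf_centered_sqr => //.
  + exact: (measurable_row sgV).
  + exact: (row_mgf sgV u i).
  + exact: (row_second_moment sgV u i).
  + by rewrite s2 mulrA ler_pdivrMr.
rewrite lee_fin ler_expR sumr_const card_ord -[leLHS]mulr_natl.
rewrite (_ : s ^+ 4 = (K / n%:R) ^+ 2); last by rewrite -s2 -exprM.
by rewrite le_eqVlt; apply/orP; left; apply/eqP; field; rewrite gt_eqF.
Qed.

(** For U frozen, the sum is linear in the rows of V, hence sub-Gaussian with
    a variance proxy that is a sum of squares of the (U w)_i; the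
    expectation over U of the resulting exponential is a product of moment
    generating functions of squares. *)
Lemma bernstein_cross n q r (V : T -> 'M[R]_(n, q)) (U : T -> 'M[R]_(n, r))
    SigmaV SigmaU (a b : R) (u : 'cV[R]_q) (w : 'cV[R]_r) :
  (0 < n)%N -> 0 <= a -> 0 <= b ->
  sub_gaussian_mx P V SigmaV a -> sub_gaussian_mx P U SigmaU b ->
  (forall A B, sigma_of V A -> sigma_of U B -> P (A `&` B) = (P A * P B)%E) ->
  bernstein_mgf n (fun t => \sum_i (V t *m u) i 0 * (U t *m w) i 0)
    (a * l2norm u * (b * l2norm w)).
Proof.
move=> n0 a0 b0 sgV sgU indVU; have nR : 0 < n%:R :> R by rewrite ltr0n.
have rV : random_mx V by case: sgV.
have rU : random_mx U by case: sgU.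
pose s := (Num.sqrt n%:R)^-1 * (a * l2norm u).
pose s' := (Num.sqrt n%:R)^-1 * (b * l2norm w).
have s0 : 0 <= s' by rewrite mulr_ge0 ?invr_ge0 ?sqrtr_ge0// mulr_ge0// sqrtr_ge0.
set K := a * _ * _.
have ss : s * s' = K / n%:R.
  rewrite /s /s' mulrACA -expr2 exprVn sqr_sqrtr ?ler0n// mulrC; congr (_ / _).
split.
  apply: measurable_sum => i.
  by apply: measurable_funM; [exact: (measurable_row sgV)|exact: (measurable_row sgU)].
move=> l lK.
(* mu is the coefficient of the squares of U w in the exponent left by
   integrating over V *)
pose mu := s ^+ 2 * l ^+ 2 / 2.
have mu0 : 0 <= mu by rewrite divr_ge0// mulr_ge0// sqr_ge0.
have K0 : 0 <= K.
  by rewrite mulr_ge0// mulr_ge0 ?sqrtr_ge0.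
have mus : mu * s' ^+ 2 = (l ^+ 2 * K ^+ 2 / n%:R ^+ 2) / 2.
  rewrite /mu (_ : _ * _ = (s * s') ^+ 2 * l ^+ 2 / 2); last by ring.
  by rewrite ss; field; rewrite gt_eqF.
pose f (z : T * T) := expR (l * \sum_i (V z.1 *m u) i 0 * (U z.2 *m w) i 0).
pose h (t : T) := expR (\sum_i mu * (U t *m w) i 0 ^+ 2).
apply: (@le_trans _ _ (\int[P]_t (h t)%:E)%E).
  apply: (@integral_decouple_le _ _ _ P (sigma_of V) (sigma_of U) f h) => //.
  - exact: sigma_algebra_sigma_of.
  - exact: sigma_algebra_sigma_of.
  - exact: sigma_of_measurable.
  - exact: sigma_of_measurable.
  - apply: measurableT_comp => //; apply: measurable_funM => //.
    apply: measurable_sum => i; apply: measurable_funM.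
      exact: (measurableT_comp (@measurable_mulmx_col _ _ _ _ _ V u i) measurable_fst).
    exact: (measurableT_comp (@measurable_mulmx_col _ _ _ _ _ U w i) measurable_snd).
  - by move=> z; exact: expR_ge0.
  - apply: measurableT_comp => //; apply: measurable_sum => i.
    apply: measurable_funM => //; apply: measurable_funX.
    exact: (measurable_row sgU).
  - move=> t; rewrite /f /=.
    under eq_integral => x _ do rewrite mulr_sumr.
    apply: (integral_expR_sum_rows rV) => [|i|i]; first by case: sgV.
      apply: measurable_funM => //; apply: measurable_funM => //.
      exact: measurable_row_sigma.
    under eq_integral => x _ do rewrite mulrCA mulrC.
    apply: le_trans (row_mgf sgV u i _) _.
    rewrite lee_fin ler_expR le_eqVlt; apply/orP; left; apply/eqP.
    by rewrite /mu -/s; ring.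
apply: le_trans (integral_expR_sum_rows (b := fun=> 2 ^+ 12 * mu * s' ^+ 2) rU _ _ _) _.
- by case: sgU.
- move=> i; apply: measurable_funM => //; apply: measurable_funX.
  exact: measurable_row_sigma.
- move=> i; apply: mgf_sqr => //.
  + exact: (measurable_row sgU).
  + exact: (row_mgf sgU w i).
  + rewrite mus.
    have : (`|l| * K / n%:R) ^+ 2 <= (8^-1) ^+ 2.
      have h0 : 0 <= `|l| * K / n%:R by rewrite divr_ge0// mulr_ge0.
      have h8 : `|l| * K / n%:R <= 8^-1 by rewrite ler_pdivrMr.
      by rewrite lerXn2r ?nnegrE.
    rewrite -[l ^+ 2]real_normK ?num_real// -exprMn -expr_div_n.
    by set x := _ ^+ 2; lra.
rewrite lee_fin ler_expR sumr_const card_ord -[leLHS]mulr_natl.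
rewrite -[2 ^+ 12 * mu * _]mulrA mus.
set x := l ^+ 2 * K ^+ 2.
have x0 : 0 <= x / n%:R by rewrite divr_ge0// mulr_ge0// sqr_ge0.
rewrite -[2 ^+ 14 * _ * _]mulrA -/x -[leRHS]mulrA.
rewrite [leLHS](_ : _ = 2 ^+ 11 * (x / n%:R)); last by field; rewrite gt_eqF.
by rewrite ler_wpM2r//; lra.
Qed.

End bernstein.

(** * Tails and the union bound *)

Section tails.
Context (d : measure_display) (T : measurableType d) (R : realType).
Variable P : probability T R.

Lemma bernstein_mgfN n (S : T -> R) K :
  bernstein_mgf P n S K -> bernstein_mgf P n (fun t => - S t) K.
Proof.
move=> [mS HS]; split; first exact: measurable_funN.
move=> l lK; have := HS (- l); rewrite normrN sqrrN => /(_ lK).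
by under eq_integral => t _ do rewrite mulNr -mulrN.
Qed.

Lemma measurable_gt_cst (f : T -> R) c : measurable_fun setT f ->
  measurable [set t | c < f t].
Proof.
move=> mf; rewrite -[X in measurable X]setTI.
rewrite (_ : [set t | _] = f @^-1` `]c, +oo[); first exact: mf.
by apply/seteqP; split=> t /=; rewrite in_itv/= andbT.
Qed.

(** Chernoff's bound with the tilt l that minimizes the exponent
    2^14 l^2 K^2 / n - l K tau; the bound on tau is the condition that this l
    is admissible. *)
Lemma bernstein_upper_tail n (S : T -> R) (K tau : R) :
  (0 < n)%N -> 0 < K -> 0 <= tau <= 2 ^+ 12 -> bernstein_mgf P n S K ->
  (P [set t | K * tau < S t]%R <= (expR (- (n%:R * tau ^+ 2 / 2 ^+ 16)))%:E)%E.
Proof.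
move=> n0 K0 /andP[tau0 tau1] [mS HS].
have nR : 0 < n%:R :> R by rewrite ltr0n.
have [->|tau_neq0] := eqVneq tau 0.
  rewrite (_ : _ / _ = 0) ?oppr0 ?expR0; last by rewrite expr0n/= mulr0 mul0r.
  exact: probability_le1 (measurable_gt_cst _ mS).
have taugt0 : 0 < tau by rewrite lt_neqAle eq_sym tau_neq0.
pose l : R := n%:R * tau / (2 ^+ 15 * K).
have l0 : 0 < l by rewrite divr_gt0 ?mulr_gt0// exprn_gt0.
pose XS : {RV P >-> R} := HB.pack S (isMeasurableFun.Build _ _ _ _ _ mS).
apply: (@le_trans _ _ (P [set t | XS t >= K * tau])%R).
  apply: le_measure; rewrite ?inE.
  - exact: measurable_gt_cst.
  - rewrite -[X in measurable X]setTI.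
    rewrite (_ : [set t | _] = S @^-1` `[K * tau, +oo[); first exact: (mS measurableT _ (measurable_itv _)).
    by apply/seteqP; split=> t /=; rewrite in_itv/= andbT.
  - by move=> t /= /ltW.
apply: le_trans (chernoff XS (K * tau) l0) _.
have -> : ('M_P XS l = \int[P]_t (expR (l * S t))%:E)%E.
  by rewrite /mmt_gen_fun unlock; apply: eq_integral => t _ /=; rewrite mulrC.
have lK : `|l| * K <= 8^-1 * n%:R.
  rewrite gtr0_norm// (_ : l * K = n%:R * tau / 2 ^+ 15); last first.
    by rewrite /l; field; rewrite gt_eqF.
  rewrite ler_pdivrMr ?exprn_gt0//.
  apply: (@le_trans _ _ (n%:R * 2 ^+ 12)); first by rewrite ler_wpM2l// ltW.
  by rewrite le_eqVlt; apply/orP; left; apply/eqP; field.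
apply: le_trans (lee_wpmul2r _ (HS l lK)) _; first by rewrite lee_fin expR_ge0.
rewrite -EFinM -expRD lee_fin ler_expR le_eqVlt; apply/orP; left; apply/eqP.
by rewrite /l; field; rewrite !gt_eqF.
Qed.

(** When K = 0 there is no optimal tilt, but all tilts are admissible, and S
    vanishes almost surely because its second moment does. *)
Lemma bernstein_tail n (S : T -> R) (K tau : R) :
  (0 < n)%N -> 0 <= K -> 0 <= tau <= 2 ^+ 12 -> bernstein_mgf P n S K ->
  (P [set t | K * tau < `|S t|]%R <=
     (2 * expR (- (n%:R * tau ^+ 2 / 2 ^+ 16)))%:E)%E.
Proof.
move=> n0 K0 tauI HS; have mS := HS.1.
have [K_eq0|K_neq0] := eqVneq K 0.
  have S0 : subgaussian_mgf P S 0.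
    move=> l; have := HS.2 l; rewrite K_eq0 mulr0 => /(_ _).
    rewrite expr0n/= mulr0 !mul0r; apply.
    by rewrite mulr_ge0.
  have msq : measurable_fun setT (fun t => (S t ^+ 2)%:E).
    by apply/measurable_EFinP; exact: measurable_funX.
  have [+ _] := (ae_eq_integral_abs P measurableT msq).
  under eq_integral => t _ do rewrite gee0_abs ?lee_fin ?sqr_ge0//.
  have : (\int[P]_t (S t ^+ 2)%:E = 0)%E.
    apply/eqP; rewrite eq_le; apply/andP; split.
      by have := integral_sqr_le mS (lexx 0) S0; rewrite expr0n mulr0.
    by apply: integral_ge0 => t _; rewrite lee_fin sqr_ge0.
  move=> -> /(_ erefl) ae0.
  rewrite (_ : P _ = 0%E); first by rewrite lee_fin mulr_ge0// expR_ge0.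
  apply: measure_negligible.
    by apply: measurable_gt_cst; exact: measurableT_comp.
  apply: negligibleS ae0 => t /=; rewrite K_eq0 mul0r normr_gt0 => St h.
  by have [/eqP] := h Logic.I; rewrite sqrf_eq0 (negPf St).
have Kgt0 : 0 < K by rewrite lt_neqAle eq_sym K_neq0.
apply: (@le_trans _ _ (P ([set t | K * tau < S t] `|` [set t | K * tau < - S t])%R)).
  apply: le_measure; rewrite ?inE.
  - by apply: measurable_gt_cst; exact: measurableT_comp.
  - apply: measurableU; apply: measurable_gt_cst => //.
    exact: measurable_funN.
  - by move=> t /=; rewrite lter_normr => /orP.
apply: le_trans (measureU2 _ _ _) _.
- exact: measurable_gt_cst.
- by apply: measurable_gt_cst; exact: measurable_funN.
rewrite mulr_natl mulr2n EFinD; apply: leeD; apply: bernstein_upper_tail => //.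
exact: bernstein_mgfN.
Qed.

Lemma bernstein_uniform (I : finType) n (S : I -> T -> R) (K : I -> R) (tau : R) :
  (0 < n)%N -> (forall i, 0 <= K i) -> 0 <= tau <= 2 ^+ 12 ->
  (forall i, bernstein_mgf P n (S i) (K i)) ->
  with_prob_at_least P
    (1 - #|I|%:R * (2 * expR (- (n%:R * tau ^+ 2 / 2 ^+ 16))))
    [set t | forall i, `|S i t| <= K i * tau].
Proof.
move=> n0 K0 tauI HS.
pose B i := [set t | K i * tau < `|S i t|].
have mB i : measurable (B i).
  by apply: measurable_gt_cst; apply: measurableT_comp => //; case: (HS i).
pose U := \big[setU/set0]_i B i.
have mU : measurable U by apply: bigsetU_measurable.
exists (~` U); split; first exact: measurableC.
- move=> t /= nU i; rewrite leNgt; apply/negP => Bi; apply: nU.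
  by rewrite /U (bigD1 i)//=; left.
- have PU : (measurable U /\ P U <= \sum_(i : I)
      (2 * expR (- (n%:R * tau ^+ 2 / 2 ^+ 16)))%:E)%E.
    rewrite /U; elim/big_ind2 : _ => [|A x A' x' [mA Ax] [mA' Ax']|i _].
    + by rewrite measure0.
    + split; first exact: measurableU.
      by apply: le_trans (measureU2 _ mA mA') _; exact: leeD.
    + by split => //; exact: bernstein_tail.
  rewrite probability_setC// EFinB leeB//.
  by rewrite mulr_natl -sumr_const -sumEFin; exact: PU.2.
Qed.

End tails.

(** * The design model *)

Section design.
Context (d : measure_display) (T : measurableType d) (R : realType).
Variable P : probability T R.

Lemma mutually_independent_pair (I : finType) (F : I -> set (set T)) i j A B :
  mutually_independent P F -> i != j -> F i A -> F j B ->
  P (A `&` B) = (P A * P B)%E.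
Proof.
move=> indF ij FA FB; pose E x := if x == i then A else B.
have ji : (j == i) = false by rewrite eq_sym; exact/negbTE.
have := indF [set i; j]%SET E _.
rewrite big_setU1/= ?inE// big_set1 /E eqxx ji => <-.
  congr (P _); apply/seteqP; split=> t /=.
    by move=> [At Bt] x /=; rewrite !inE => /orP[/eqP->|/eqP->]; rewrite ?eqxx ?ji.
  move=> h; split.
    by have := h i; rewrite /= !inE eqxx; apply.
  by have := h j; rewrite /= !inE eqxx orbT ji; apply.
by move=> x; rewrite !inE => /orP[/eqP->|/eqP->]; rewrite ?eqxx ?ji.
Qed.

Lemma sub_gaussian_mx_sym n q (V : T -> 'M[R]_(n, q)) Sigma (a : R) :
  (0 < n)%N -> sub_gaussian_mx P V Sigma a -> Sigma^T = Sigma.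
Proof.
move=> n0 sgV; apply/matrixP => j l; rewrite mxE.
have [_ h1] := integral_entry_mul sgV (Ordinal n0) j l.
have [_ h2] := integral_entry_mul sgV (Ordinal n0) l j.
move: h1; under eq_integral => t _ do rewrite mulrC.
rewrite h2 => -[]; apply: mulfI.
by rewrite invr_eq0 pnatr_eq0 -lt0n.
Qed.

(** For a = 1 this bounds lambda_min by 8, which keeps the deviation level
    within the range of the Bernstein tail. *)
Lemma second_moment_le n q (V : T -> 'M[R]_(n, q)) Sigma (a : R) (u : 'cV[R]_q) :
  (0 < n)%N -> 0 <= a -> sub_gaussian_mx P V Sigma a ->
  bil Sigma u u <= 8 * (a ^+ 2 * l2norm u ^+ 2).
Proof.
move=> n0 a0 sgV; have nR : 0 < n%:R :> R by rewrite ltr0n.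
have s0 : 0 <= (Num.sqrt n%:R)^-1 * (a * l2norm u).
  by rewrite mulr_ge0 ?invr_ge0 ?sqrtr_ge0// mulr_ge0// l2norm_ge0.
have := integral_sqr_le (measurable_row sgV u (Ordinal n0)) s0
  (row_mgf sgV u (Ordinal n0)).
rewrite (row_second_moment sgV) lee_fin -/(bil Sigma u u).
rewrite exprMn exprVn sqr_sqrtr ?ler0n// exprMn.
have ni : 0 < n%:R^-1 :> R by rewrite invr_gt0.
by move=> h; rewrite -(ler_pM2l ni) mulrCA.
Qed.

(** The six families of scalars are indexed together, so that a single union
    bound covers them. *)
Lemma design_concentration n k (X W : T -> 'M[R]_(n, k)) (e : T -> 'cV[R]_n)
    (Sigma_x Sigma_w : 'M[R]_k) (sigma_w sigma sigma_e tau : R)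
    (beta : 'cV[R]_k) :
  (0 < n)%N -> 0 <= sigma_w -> 0 <= sigma_e -> 0 <= tau <= 2 ^+ 12 ->
  sub_gaussian_design P X W e Sigma_x Sigma_w sigma_w sigma sigma_e ->
  with_prob_at_least P
    (1 - (#|net k| * 6)%:R * (2 * expR (- (n%:R * tau ^+ 2 / 2 ^+ 16))))
    [set t | forall z : grid k, z \in net k ->
      let v := grid_point R z in l2norm v <= 1 ->
      [/\ `|bil ((X t)^T *m X t - Sigma_x) v v| <= tau,
          `|bil ((W t)^T *m W t - Sigma_w) v v| <= sigma_w ^+ 2 * tau &
          `|bil ((X t)^T *m W t) v v| <= sigma_w * tau] /\
      [/\ `|bil 1%:M v ((X t)^T *m e t)| <= sigma_e * tau,
          `|bil 1%:M v ((W t)^T *m e t)| <= sigma_w * sigma_e * tau &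
          `|bil 1%:M v ((X t)^T *m (W t *m beta))|
             <= sigma_w * l2norm beta * tau]].
Proof.
move=> n0 sw0 se0 tauI [sgX sgW sge indXWe].
have tau0 : 0 <= tau by case/andP: tauI.
have ind3 i j A B := @mutually_independent_pair _ _ i j A B indXWe.
have indXW A B : sigma_of X A -> sigma_of W B -> P (A `&` B) = (P A * P B)%E.
  by move=> XA WB; apply: (ind3 (@Ordinal 3 0 isT) (@Ordinal 3 1 isT)).
have indXe A B : sigma_of X A -> sigma_of e B -> P (A `&` B) = (P A * P B)%E.
  by move=> XA WB; apply: (ind3 (@Ordinal 3 0 isT) (@Ordinal 3 2 isT)).
have indWe A B : sigma_of W A -> sigma_of e B -> P (A `&` B) = (P A * P B)%E.
  by move=> XA WB; apply: (ind3 (@Ordinal 3 1 isT) (@Ordinal 3 2 isT)).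
pose N := {z : grid k | z \in net k}.
pose pt (z : N) : 'cV[R]_k := grid_point R (val z).
(* e enters the cross bounds as an n x 1 matrix tested against 1 *)
pose one : 'cV[R]_1 := const_mx 1.
have one1 : l2norm one = 1 by rewrite /l2norm big_ord1 mxE expr1n sqrtr1.
(* the six families of scalars, with their scales, per net point *)
pose S (i : N * 'I_6) (t : T) : R := let v := pt i.1 in
  nth 0 [:: \sum_j (X t *m v) j 0 ^+ 2 - (v^T *m Sigma_x *m v) 0 0;
    \sum_j (W t *m v) j 0 ^+ 2 - (v^T *m Sigma_w *m v) 0 0;
    \sum_j (X t *m v) j 0 * (W t *m v) j 0;
    \sum_j (X t *m v) j 0 * (e t *m one) j 0;
    \sum_j (W t *m v) j 0 * (e t *m one) j 0;
    \sum_j (X t *m v) j 0 * (W t *m beta) j 0] i.2.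
pose K (i : N * 'I_6) : R := let v := pt i.1 in
  nth 0 [:: 1 ^+ 2 * l2norm v ^+ 2; sigma_w ^+ 2 * l2norm v ^+ 2;
    1 * l2norm v * (sigma_w * l2norm v); 1 * l2norm v * (sigma_e * l2norm one);
    sigma_w * l2norm v * (sigma_e * l2norm one); 1 * l2norm v * (sigma_w * l2norm beta)] i.2.
have K0 i : 0 <= K i.
  case: i => z [[|[|[|[|[|[|//]]]]]] ?]; rewrite /K/=;
    by rewrite !mulr_ge0 ?exprn_ge0 ?mulr_ge0 ?l2norm_ge0.
have SB i : bernstein_mgf P n (S i) (K i).
  case: i => z [[|[|[|[|[|[|//]]]]]] ?]; rewrite /K/S/=.
  - exact: bernstein_quadratic.
  - exact: bernstein_quadratic.
  - exact: (bernstein_cross _ _ n0 ler01 sw0 sgX sgW).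
  - exact: (bernstein_cross _ _ n0 ler01 se0 sgX sge).
  - exact: (bernstein_cross _ _ n0 sw0 se0 sgW sge).
  - exact: (bernstein_cross _ _ n0 ler01 sw0 sgX sgW).
have [A [mA AS PA]] := bernstein_uniform n0 K0 tauI SB.
have card_index : #|{: N * 'I_6}| = (#|net k| * 6)%N.
  by rewrite card_prod card_sig card_ord.
exists A; split => //; last by rewrite -card_index.
move=> t /AS /= St z zN z1; set v := grid_point R z in z1 *.
have SN (j : 'I_6) : `|S (exist _ z zN, j) t| <= K (exist _ z zN, j) * tau by [].
have shrink (c : R) : 0 <= c -> c * l2norm v * tau <= c * tau.
  by move=> c0; rewrite ler_wpM2r// ler_piMr.
have shrink2 (c : R) : 0 <= c -> c * l2norm v ^+ 2 * tau <= c * tau.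
  by move=> c0; rewrite ler_wpM2r// ler_piMr// exprn_ile1 ?l2norm_ge0.
have e_one : e t *m one = e t.
  by apply/matrixP => i j; rewrite mxE big_ord1 !mxE mulr1 !ord1.
split; split.
- rewrite bil_addmx bil_oppmx bil_gram; under eq_bigr => i _ do rewrite -expr2.
  apply: le_trans (SN (@Ordinal 6 0 isT)) _.
  by rewrite /K/= expr1n; apply: le_trans (shrink2 _ ler01) _; rewrite mul1r.
- rewrite bil_addmx bil_oppmx bil_gram; under eq_bigr => i _ do rewrite -expr2.
  apply: le_trans (SN (@Ordinal 6 1 isT)) _.
  by apply: shrink2; exact: sqr_ge0.
- rewrite bil_gram; apply: le_trans (SN (@Ordinal 6 2 isT)) _.
  rewrite /K/= mul1r -/v [l2norm v * (_ * _)]mulrCA -expr2; exact: shrink2.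
- rewrite -{1}e_one bil_trmul; apply: le_trans (SN (@Ordinal 6 3 isT)) _.
  rewrite /K/= mul1r one1 mulr1 -/v [l2norm v * _]mulrC; exact: shrink.
- rewrite -{1}e_one bil_trmul; apply: le_trans (SN (@Ordinal 6 4 isT)) _.
  rewrite /K/= one1 mulr1 [sigma_w * _ * sigma_e]mulrAC; apply: shrink.
  exact: mulr_ge0.
- rewrite bil_trmul; apply: le_trans (SN (@Ordinal 6 5 isT)) _.
  rewrite /K/= mul1r -/v [l2norm v * (_ * _)]mulrC; apply: shrink.
  by rewrite mulr_ge0// l2norm_ge0.
Qed.

End design.

(** The net has at most 64^k <= p^(6 k) points, since p >= 2, and each of them
    fails with probability of order p^(-16 k). *)
Lemma net_failure_le (R : realType) (k p : nat) : (0 < k)%N -> (1 < p)%N ->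
  (#|net k| * 6)%:R * (2 * expR (- ((16 * k)%:R * ln p%:R)))
    <= 12 * p%:R `^ (- 1) :> R.
Proof.
move=> k0 p1; have p0 : (0 < p)%N by exact: ltnW.
have pR : 0 < p%:R :> R by rewrite ltr0n.
rewrite -mulrN expRM_natl expRN lnK ?posrE// powR_inv1 ?ler0n//.
have pV0 : 0 <= p%:R^-1 :> R by rewrite invr_ge0.
have pV1 : p%:R^-1 <= 1 :> R by rewrite invf_le1// ler1n.
have card_le : #|net k|%:R <= p%:R ^+ (6 * k) :> R.
  apply: le_trans (card_net R k) _; rewrite exprM lerXn2r ?nnegrE ?exprn_ge0//.
  rewrite (_ : 64 = 2 ^+ 6); last by ring.
  by rewrite lerXn2r ?nnegrE// ler_nat.
have -> : (16 * k)%N = (6 * k + (1 + (10 * k).-1))%N.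
  by rewrite add1n prednK ?muln_gt0// -mulnDl.
rewrite exprD exprD expr1 natrM.
have q1 : p%:R^-1 ^+ (10 * k).-1 <= 1 :> R by rewrite exprn_ile1.
have q2 : #|net k|%:R * p%:R^-1 ^+ (6 * k) <= 1 :> R.
  by rewrite exprVn ler_pdivrMr ?exprn_gt0// mul1r.
have q10 : 0 <= p%:R^-1 ^+ (10 * k).-1 :> R by rewrite exprn_ge0.
rewrite (_ : _ * _ = 12 * ((#|net k|%:R * p%:R^-1 ^+ (6 * k)) *
  (p%:R^-1 * p%:R^-1 ^+ (10 * k).-1))); last by ring.
rewrite ler_pM2l// -[leRHS]mul1r.
by apply: ler_pM => //; rewrite ler_piMr.
Qed.

Theorem corollary8 (R : realType) :
  exists c C C1 C2 : R,
    [/\ 0 < c, 0 < C, 0 < C1 & 0 < C2] /\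
    forall (d : measure_display) (T : measurableType d) (P : probability T R)
      (n k p : nat)
      (X W : T -> 'M[R]_(n, k)) (e : T -> 'cV[R]_n)
      (Sigma_x Sigma_w : 'M[R]_k) (sigma_w sigma sigma_e : R)
      (beta : 'cV[R]_k),
      (0 < n)%N -> (0 < k)%N -> (k <= p)%N ->
      0 <= sigma_w -> 0 <= sigma_e ->
      sub_gaussian_design P X W e Sigma_x Sigma_w sigma_w sigma sigma_e ->
      0 < lambda_min Sigma_x ->
      c * ((1 + sigma_w ^+ 2) ^+ 2 / lambda_min Sigma_x ^+ 2)
        * (k%:R * ln p%:R) <= n%:R ->
      with_prob_at_least P (1 - C1 * p%:R `^ (- C2))
        [set t |
          let Z := X t + W t in
          let y := X t *m beta + e t in
          let Sigma_hat := Z^T *m Z - Sigma_w in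
          let gamma_hat := Z^T *m y in
          let beta_hat := invmx Sigma_hat *m gamma_hat in
          posdef Sigma_hat /\
          l2norm (beta_hat - beta) <=
            C * (((sigma_w + sigma_w ^+ 2) * l2norm beta
                   + sigma_e * Num.sqrt (1 + sigma_w ^+ 2))
                 / lambda_min Sigma_x)
              * Num.sqrt (k%:R * ln p%:R / n%:R)].
Proof.
(* the deviation level is tau = 2^10 eps with eps = sqrt (k log p / n); then
   c = 2^26 amounts to 8 (1 + sigma_w^2) tau <= lambda_min, C = 2^13 is
   8 * 2^10, and C1 = 6 * 2 counts two-sided tails of six families *)
exists (2 ^+ 26), (2 ^+ 13), 12, 1.
split; first by split; rewrite ?exprn_gt0.
move=> d T P n k p X W e Sx Sw sw s se beta n0 k0 kp sw0 se0.
move=> sgXWe lam0 hn; have [sgX sgW _ _] := sgXWe.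
have p0 : (0 < p)%N by exact: leq_trans kp.
have [p1|p1] := leqP p 1.
  (* for p = 1 the logarithm vanishes, but the claimed probability is
     negative, so the empty event will do *)
  have -> : p = 1%N by apply/eqP; rewrite eqn_leq p1.
  exists set0; split => //; rewrite measure0 lee_fin powR1; lra.
have nR : 0 < n%:R :> R by rewrite ltr0n.
have kR : 0 < k%:R :> R by rewrite ltr0n.
have pR : 0 < p%:R :> R by rewrite ltr0n.
have lnp0 : 0 <= ln p%:R :> R by apply: ln_ge0; rewrite ler1n.
set lam := lambda_min Sx in lam0 hn *.
set eps := Num.sqrt (k%:R * ln p%:R / n%:R).
pose tau : R := 2 ^+ 10 * eps.
have eps0 : 0 <= eps by exact: sqrtr_ge0.
have tau0 : 0 <= tau by rewrite mulr_ge0// exprn_ge0.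
have eps2 : eps ^+ 2 = k%:R * ln p%:R / n%:R.
  by rewrite sqr_sqrtr// divr_ge0 ?mulr_ge0 ?ler0n.
have V1 : 0 <= 1 + sw ^+ 2 by rewrite addr_ge0// sqr_ge0.
have small : 2 ^+ 13 * ((1 + sw ^+ 2) * eps) <= lam.
  rewrite -ler_sqr ?nnegrE ?mulr_ge0 ?exprn_ge0 ?(ltW lam0)//.
  rewrite [leLHS](_ : _ = 2 ^+ 26 * (1 + sw ^+ 2) ^+ 2 * eps ^+ 2); last by ring.
  rewrite eps2 mulrA ler_pdivrMr//.
  have := ler_wpM2l (ltW (exprn_gt0 2 lam0)) hn.
  apply: le_trans; rewrite le_eqVlt; apply/orP; left; apply/eqP.
  by field; rewrite gt_eqF.
have small_tau : 8 * ((1 + sw ^+ 2) * tau) <= lam.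
  by apply: le_trans small; rewrite /tau le_eqVlt; apply/orP; left; apply/eqP; ring.
have symx := sub_gaussian_mx_sym n0 sgX.
have symw := sub_gaussian_mx_sym n0 sgW.
have lam8 : lam <= 8.
  pose u : 'cV[R]_k := delta_mx (Ordinal k0) 0.
  have u0 : u != 0.
    by apply/eqP => /matrixP/(_ (Ordinal k0) 0)/eqP; rewrite !mxE !eqxx oner_eq0.
  have := le_trans (lambda_min_le u symx) (second_moment_le u n0 ler01 sgX).
  by rewrite expr1n mul1r ler_pM2r// exprn_gt0// l2norm_gt0.
have tauI : 0 <= tau <= 2 ^+ 12.
  have e1 : eps <= (1 + sw ^+ 2) * eps by rewrite ler_peMl// lerDl sqr_ge0.
  have c0 : 0 <= 2 ^+ 13 :> R by rewrite exprn_ge0.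
  rewrite tau0/=; have := le_trans (ler_wpM2l c0 e1) (le_trans small lam8).
  by rewrite /tau; lra.
have [A [mA AS PA]] := design_concentration beta n0 sw0 se0 tauI sgXWe.
exists A; split => //; last first.
  apply: le_trans PA; rewrite lee_fin lerD2l lerN2.
  have -> : n%:R * tau ^+ 2 / 2 ^+ 16 = (16 * k)%:R * ln p%:R.
    by rewrite /tau exprMn eps2 natrM; field; rewrite gt_eqF.
  exact: net_failure_le.
move=> t /AS /= St.
have Hxx z zN z1 := let: conj (And3 h _ _) _ := St z zN z1 in h.
have Hww z zN z1 := let: conj (And3 _ h _) _ := St z zN z1 in h.
have Hxw z zN z1 := let: conj (And3 _ _ h) _ := St z zN z1 in h.
have Hxe z zN z1 := let: conj _ (And3 h _ _) := St z zN z1 in h.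
have Hwe z zN z1 := let: conj _ (And3 _ h _) := St z zN z1 in h.
have Hxwb z zN z1 := let: conj _ (And3 _ _ h) := St z zN z1 in h.
split; first exact: (Sigma_hat_posdef k0 tau0 symx symw lam0 small_tau Hxx Hww Hxw).
apply: le_trans (estimator_error k0 sw0 se0 tau0 symx symw lam0 small_tau
  Hxx Hww Hxw Hxe Hwe Hxwb) _.
by rewrite /tau le_eqVlt; apply/orP; left; apply/eqP; ring.
Qed.
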